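(* Let $(b_n)_{n\ge 0}$ and $(e_n)_{n\ge 0}$ be sequences of real numbers satisfying: (1) $b_n>0$ for all sufficiently large $n$; (2) there is a constant $C$ such that $\displaystyle \frac{\sum_{k=0}^{2n} b_k}{\sum_{k=0}^{n} b_k}<C$ for all sufficiently large $n$; (3) $\displaystyle\limsup_{n\to\infty} b_n<1$; (4) $\displaystyle\lim_{n\to\infty}\frac{\left(\sum_{k=0}^n b_k^2\right)\left(\sum_{k=0}^n e_k^2\right)}{\left(\sum_{k=0}^n b_k\right)^3}=0$. Then there is no set $A\subseteq\mathbb{N}$ such that for every $N\ge 0$ $$\sum_{n=0}^N R_A(n)=\sum_{n=0}^N\sum_{k=0}^n b_kb_{n-k}+e_N .$$
   Context: $\mathbb{N}$ denotes the set of non-negative integers. For $A\subseteq\mathbb{N}$, $R_A(n)$ denotes the number of ordered pairs $(a,a')$ with $a,a'\in A$ and $a+a'=n$; equivalently $R_A(n)=\sum_{k=0}^n\chi_A(k)\chi_A(n-k)$ where $\chi_A$ is the characteristic function of $A$. *)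

(* Defs.v *)
From Stdlib Require Import Reals.
From Coquelicot Require Import Coquelicot.
Open Scope R_scope.

Definition chi (A : nat -> bool) (k : nat) : R := if A k then 1 else 0.

Definition RA (A : nat -> bool) (n : nat) : R :=
  sum_f_R0 (fun k => chi A k * chi A (n - k)%nat) n.

Definition psum (u : nat -> R) (n : nat) : R := sum_f_R0 u n.

Definition conv (b : nat -> R) (n : nat) : R :=
  sum_f_R0 (fun k => b k * b (n - k)%nat) n.

(* Main.v *)
(** If [A] existed, the power series of [chi A], [b] and [e] would satisfy
    [A(u)^2 = B(u)^2 + (1 - u) E(u)] on the unit disk.

    When [psum b] diverges, one follows Erdos and Fuchs: multiply by [|P(u)|^2] with
    [P = 1 + u + ... + u^m] and average over the circle [|u|^2 = x < 1]. By Parseval, and because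
    the coefficients of [P A] are natural numbers, the left side is at least [P(x) A(x)], while
    the right side is at most [(m + 1) P(x) Sb(x)] plus an error controlled by [Se(x)], where
    [Sb = sum b_n^2 x^n] and [Se = sum e_n^2 x^n]. Taking [m + 1] about [kappa B(x) / Sb(x)] gives
    [A(x) <= Sb(x) + 3 kappa B(x)], which contradicts [A(x) ~ B(x)] as [x] tends to [1], since
    [Sb(x) <= rho B(x) + O(1)] with [rho < 1]. The doubling hypothesis transfers
    the smallness of the error from partial sums to power series. The average over the circle is
    taken for truncated series, where it is a mean over roots of unity.

    When [psum b] converges, the hypotheses force [e = 0], so [A^2 = B^2] and [b = chi A] or
    [b = - chi A], against [0 < b n < 1] for large [n]. *)

Require Import Defs.
From Stdlib Require Import Reals Lra Lia Classical.
From Coquelicot Require Import Coquelicot.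
Open Scope R_scope.

(** * Powers and finite sums *)

Lemma pow_le_1 (x : R) n : 0 <= x <= 1 -> x ^ n <= 1.
Proof. intros Hx. rewrite <- (pow1 n). apply pow_incr, Hx. Qed.

Lemma pow_antitone (x : R) m n : 0 <= x <= 1 -> (m <= n)%nat -> x ^ n <= x ^ m.
Proof.
  intros Hx Hmn. replace n with (m + (n - m))%nat by lia. rewrite pow_add.
  rewrite <- (Rmult_1_r (x ^ m)) at 2.
  apply Rmult_le_compat_l; [apply pow_le; lra | apply pow_le_1, Hx].
Qed.

Lemma bernoulli_pow (x : R) n : 0 <= x <= 1 -> 1 - INR n * (1 - x) <= x ^ n.
Proof.
  intros Hx. induction n as [|n IH]; [simpl; lra|].
  rewrite S_INR. simpl.
  assert (x * (1 - INR n * (1 - x)) <= x * x ^ n) by (apply Rmult_le_compat_l; lra).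
  assert (0 <= INR n * (1 - x) ^ 2) by (apply Rmult_le_pos; [apply pos_INR | apply pow2_ge_0]).
  lra.
Qed.

Lemma psum_sum_n (f : nat -> R) n : psum f n = sum_n f n.
Proof. symmetry. apply sum_n_Reals. Qed.

(* Instances at [R] and [C] of lemmas on [sum_n], stated with the operations that [ring] knows. *)
Lemma sum_n_Rext (f g : nat -> R) n :
  (forall k, (k <= n)%nat -> f k = g k) -> sum_n f n = sum_n g n.
Proof. apply sum_n_ext_loc. Qed.

Lemma sum_n_Cext (f g : nat -> C) n :
  (forall k, (k <= n)%nat -> f k = g k) -> sum_n f n = sum_n g n.
Proof. apply sum_n_ext_loc. Qed.

Lemma sum_n_Rplus (f g : nat -> R) n : sum_n (fun k => f k + g k) n = sum_n f n + sum_n g n.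
Proof. exact (sum_n_plus f g n). Qed.

Lemma sum_n_Rmult_l (c : R) (f : nat -> R) n : sum_n (fun k => c * f k) n = c * sum_n f n.
Proof. exact (sum_n_mult_l (K := R_Ring) c f n). Qed.

Lemma sum_n_Rmult_r (c : R) (f : nat -> R) n : sum_n (fun k => f k * c) n = sum_n f n * c.
Proof. exact (sum_n_mult_r (K := R_Ring) c f n). Qed.

Lemma sum_n_Cplus (f g : nat -> C) n :
  sum_n (fun k => f k + g k)%C n = (sum_n f n + sum_n g n)%C.
Proof. exact (sum_n_plus f g n). Qed.

Lemma sum_n_Cmult_l (c : C) (f : nat -> C) n : sum_n (fun k => c * f k)%C n = (c * sum_n f n)%C.
Proof. exact (sum_n_mult_l (K := C_Ring) c f n). Qed.

Lemma sum_Sn_R (f : nat -> R) n : sum_n f (S n) = sum_n f n + f (S n).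
Proof. exact (sum_Sn f n). Qed.

Lemma sum_Sn_C (f : nat -> C) n : sum_n f (S n) = (sum_n f n + f (S n))%C.
Proof. exact (sum_Sn f n). Qed.

Lemma sum_n_le (f g : nat -> R) n :
  (forall k, (k <= n)%nat -> f k <= g k) -> sum_n f n <= sum_n g n.
Proof. intros H. rewrite !sum_n_Reals. apply sum_Rle, H. Qed.

Lemma sum_n_nonneg (f : nat -> R) n :
  (forall k, (k <= n)%nat -> 0 <= f k) -> 0 <= sum_n f n.
Proof.
  intros H. apply Rle_trans with (sum_n (fun _ => 0) n); [|apply sum_n_le, H].
  rewrite sum_n_const. lra.
Qed.

Lemma sum_n_increment_le (f g : nat -> R) m n :
  (m <= n)%nat -> (forall k, (m < k <= n)%nat -> f k <= g k) ->
  sum_n f n - sum_n f m <= sum_n g n - sum_n g m.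
Proof.
  intros Hmn. induction Hmn as [|n Hmn IH]; intros H; [lra|].
  rewrite !sum_Sn_R.
  assert (f (S n) <= g (S n)) by (apply H; lia).
  assert (sum_n f n - sum_n f m <= sum_n g n - sum_n g m) by (apply IH; intros; apply H; lia).
  lra.
Qed.

Lemma sum_n_le_index (f : nat -> R) m n :
  (m <= n)%nat -> (forall k, (m < k <= n)%nat -> 0 <= f k) -> sum_n f m <= sum_n f n.
Proof.
  intros Hmn H. pose proof (sum_n_increment_le (fun _ => 0) f m n Hmn H) as Hle.
  rewrite !sum_n_const in Hle. lra.
Qed.

Lemma psum_monotone (f : nat -> R) n0 m n :
  (forall k, (n0 <= k)%nat -> 0 <= f k) -> (n0 <= m <= n)%nat -> psum f m <= psum f n.
Proof.
  intros Hf Hmn. rewrite !psum_sum_n. apply sum_n_le_index; [lia|]. intros; apply Hf; lia.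
Qed.

Lemma psum_nonneg (f : nat -> R) n : (forall k, 0 <= f k) -> 0 <= psum f n.
Proof. intros Hf. rewrite psum_sum_n. apply sum_n_nonneg. auto. Qed.

Lemma psum_ge_term (f : nat -> R) m n :
  (forall k, 0 <= f k) -> (m <= n)%nat -> f m <= psum f n.
Proof.
  intros Hf Hmn. apply Rle_trans with (psum f m); [|apply psum_monotone with O; auto; lia].
  destruct m as [|m]; [apply Rle_refl|].
  pose proof (psum_nonneg f m Hf). unfold psum in *. simpl. lra.
Qed.

Lemma sum_n_antidiagonal {G : AbelianMonoid} (F : nat -> nat -> G) n :
  sum_n (fun m => sum_n (fun k => F k (m - k)%nat) m) n
  = sum_n (fun i => sum_n (F i) (n - i)) n.
Proof.
  induction n as [|n IH]; [rewrite !sum_O; reflexivity|].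
  rewrite sum_Sn, IH, !sum_Sn, Nat.sub_diag, sum_O, plus_assoc. f_equal.
  rewrite <- sum_n_plus. apply sum_n_ext_loc. intros i Hi.
  replace (S n - i)%nat with (S (n - i)) by lia. rewrite sum_Sn. reflexivity.
Qed.

Lemma RtoC_sum_n (f : nat -> R) n : RtoC (sum_n f n) = sum_n (fun k => RtoC (f k)) n.
Proof.
  induction n as [|n IH]; [rewrite !sum_O; reflexivity|].
  rewrite sum_Sn_R, sum_Sn_C, RtoC_plus, IH. reflexivity.
Qed.

Lemma Re_sum_n (f : nat -> C) n : Re (sum_n f n) = sum_n (fun k => Re (f k)) n.
Proof.
  induction n as [|n IH]; [rewrite !sum_O; reflexivity|].
  rewrite sum_Sn_R, sum_Sn_C, <- IH. reflexivity.
Qed.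

Lemma Cconj_sum_n (f : nat -> C) n : Cconj (sum_n f n) = sum_n (fun k => Cconj (f k)) n.
Proof.
  induction n as [|n IH]; [rewrite !sum_O; reflexivity|].
  rewrite !sum_Sn_C, Cplus_conj, IH. reflexivity.
Qed.

Lemma Cmod_sum_n_le (f : nat -> C) n : Cmod (sum_n f n) <= sum_n (fun k => Cmod (f k)) n.
Proof. exact (norm_sum_n_m (K := C_AbsRing) (V := C_NormedModule) f 0 n). Qed.

Lemma cauchy_schwarz_sum_n (w f g : nat -> R) n :
  (forall k, 0 <= w k) ->
  sum_n (fun k => w k * (f k * g k)) n ^ 2
  <= sum_n (fun k => w k * f k ^ 2) n * sum_n (fun k => w k * g k ^ 2) n.
Proof.
  intros Hw.
  set (X := sum_n (fun k => w k * (f k * g k)) n).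
  set (F := sum_n (fun k => w k * f k ^ 2) n).
  set (G := sum_n (fun k => w k * g k ^ 2) n).
  assert (Hquad : forall s t, 0 <= s ^ 2 * F - 2 * s * t * X + t ^ 2 * G).
  { intros s t.
    assert (Hexpand : s ^ 2 * F - 2 * s * t * X + t ^ 2 * G
      = sum_n (fun k => w k * (s * f k - t * g k) ^ 2) n).
    { unfold F, X, G. rewrite (sum_n_Rext (fun k => w k * (s * f k - t * g k) ^ 2)
        (fun k => s ^ 2 * (w k * f k ^ 2)
          + (- (2 * s * t) * (w k * (f k * g k)) + t ^ 2 * (w k * g k ^ 2))))
        by (intros; ring).
      rewrite !sum_n_Rplus, !sum_n_Rmult_l. ring. }
    rewrite Hexpand. apply sum_n_nonneg. intros k _.
    apply Rmult_le_pos; [apply Hw | apply pow2_ge_0]. }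
  pose proof (Hquad 1 0) as HF. pose proof (Hquad 0 1) as HG.
  destruct (Req_dec G 0) as [G0|G0].
  - pose proof (Hquad X ((F + 1) / 2)) as H. rewrite G0 in *. nra.
  - pose proof (Hquad G X) as H. nra.
Qed.

(** * Truncated power series *)

Definition trunc (f : nat -> R) (n : nat) (x : R) : R := sum_n (fun k => f k * x ^ k) n.

Definition Ctrunc (f : nat -> R) (n : nat) (u : C) : C :=
  sum_n (fun k => RtoC (f k) * u ^ k)%C n.

Lemma Ctrunc_RtoC (f : nat -> R) n (x : R) : Ctrunc f n (RtoC x) = RtoC (trunc f n x).
Proof.
  unfold Ctrunc, trunc. rewrite RtoC_sum_n. apply sum_n_Cext. intros k _.
  rewrite RtoC_mult, RtoC_pow. reflexivity.
Qed.

Lemma trunc_nonneg (f : nat -> R) n x : (forall k, 0 <= f k) -> 0 <= x -> 0 <= trunc f n x.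
Proof.
  intros Hf Hx. apply sum_n_nonneg. intros k _.
  apply Rmult_le_pos; [apply Hf | apply pow_le, Hx].
Qed.

Lemma Cmod_Ctrunc_le (f : nat -> R) n (u : C) :
  Cmod (Ctrunc f n u) <= trunc (fun k => Rabs (f k)) n (Cmod u).
Proof.
  eapply Rle_trans; [apply Cmod_sum_n_le|]. apply sum_n_le. intros k _.
  rewrite Cmod_mult, Cmod_R, Cmod_pow. lra.
Qed.

Lemma Cmod_Ctrunc_increment_le (f : nat -> R) m n (u : C) :
  (m <= n)%nat ->
  Cmod (Ctrunc f n u - Ctrunc f m u)
  <= trunc (fun k => Rabs (f k)) n (Cmod u) - trunc (fun k => Rabs (f k)) m (Cmod u).
Proof.
  intros Hmn. induction Hmn as [|n Hmn IH].
  - replace (_ - _)%C with (RtoC 0) by ring. rewrite Cmod_0. lra.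
  - unfold Ctrunc, trunc in *. rewrite sum_Sn_C, sum_Sn_R.
    match goal with |- Cmod (?x + ?y - ?z) <= _ =>
      replace (x + y - z)%C with (x - z + y)%C by ring;
      pose proof (Cmod_triangle (x - z) y) as Htri end.
    rewrite Cmod_mult, Cmod_R, Cmod_pow in Htri. lra.
Qed.

Lemma Ctrunc_geometric (u : C) n : ((1 - u) * Ctrunc (fun _ => 1) n u = 1 - u ^ S n)%C.
Proof.
  unfold Ctrunc. induction n as [|n IH].
  - rewrite sum_O. simpl. ring.
  - rewrite sum_Sn_C, Cmult_plus_distr_l, IH, (Cpow_S u (S n)). ring.
Qed.

Lemma trunc_geometric (x : R) n : (1 - x) * trunc (fun _ => 1) n x = 1 - x ^ S n.
Proof.
  apply RtoC_inj. rewrite RtoC_mult, !RtoC_minus, RtoC_pow, <- Ctrunc_RtoC.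
  apply Ctrunc_geometric.
Qed.

Lemma Ctrunc_PS_mult (f g : nat -> R) n (u : C) :
  Ctrunc (PS_mult f g) n u = sum_n (fun i => RtoC (f i) * u ^ i * Ctrunc g (n - i) u)%C n.
Proof.
  transitivity (sum_n (fun i =>
    sum_n (fun j => RtoC (f i) * u ^ i * (RtoC (g j) * u ^ j))%C (n - i)) n).
  - rewrite <- sum_n_antidiagonal. apply sum_n_Cext. intros m _. unfold PS_mult.
    rewrite <- sum_n_Reals, RtoC_sum_n, Cmult_comm, <- sum_n_Cmult_l.
    apply sum_n_Cext. intros k Hk.
    replace (u ^ m)%C with (u ^ k * u ^ (m - k))%C by (rewrite <- Cpow_add_r; f_equal; lia).
    rewrite RtoC_mult. ring.
  - apply sum_n_Cext. intros i _. apply sum_n_Cmult_l.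
Qed.

Lemma Ctrunc_mult_defect_sum_n (f g : nat -> R) n (u : C) :
  (Ctrunc f n u * Ctrunc g n u - Ctrunc (PS_mult f g) n u
   = sum_n (fun i => RtoC (f i) * u ^ i * (Ctrunc g n u - Ctrunc g (n - i) u)) n)%C.
Proof.
  rewrite Ctrunc_PS_mult.
  rewrite (sum_n_Cext (fun i => RtoC (f i) * u ^ i * (Ctrunc g n u - Ctrunc g (n - i) u))%C
    (fun i => Ctrunc g n u * (RtoC (f i) * u ^ i)
              + (-1) * (RtoC (f i) * u ^ i * Ctrunc g (n - i) u))%C) by (intros; ring).
  rewrite sum_n_Cplus, !sum_n_Cmult_l. unfold Ctrunc at 1. ring.
Qed.

Definition mult_defect (f g : nat -> R) (n : nat) (x : R) : R :=
  trunc f n x * trunc g n x - trunc (PS_mult f g) n x.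

Lemma mult_defect_sum_n (f g : nat -> R) n (x : R) :
  mult_defect f g n x
  = sum_n (fun i => f i * x ^ i * (trunc g n x - trunc g (n - i) x)) n.
Proof.
  unfold mult_defect. apply RtoC_inj.
  rewrite RtoC_minus, RtoC_mult, <- !Ctrunc_RtoC, Ctrunc_mult_defect_sum_n, RtoC_sum_n.
  apply sum_n_Cext. intros i _. rewrite !Ctrunc_RtoC, !RtoC_mult, RtoC_minus, RtoC_pow. reflexivity.
Qed.

Lemma Cmod_Ctrunc_mult_defect_le (f g : nat -> R) n (u : C) :
  Cmod (Ctrunc f n u * Ctrunc g n u - Ctrunc (PS_mult f g) n u)
  <= mult_defect (fun k => Rabs (f k)) (fun k => Rabs (g k)) n (Cmod u).
Proof.
  rewrite Ctrunc_mult_defect_sum_n, mult_defect_sum_n.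
  eapply Rle_trans; [apply Cmod_sum_n_le|]. apply sum_n_le. intros i _.
  rewrite !Cmod_mult, Cmod_R, Cmod_pow. apply Rmult_le_compat_l.
  - apply Rmult_le_pos; [apply Rabs_pos | apply pow_le, Cmod_ge_0].
  - apply Cmod_Ctrunc_increment_le. lia.
Qed.

Lemma Ctrunc_backward_difference (f : nat -> R) n (u : C) :
  Ctrunc (fun k => f k - PS_incr_1 f k) n u = ((1 - u) * Ctrunc f n u + RtoC (f n) * u ^ S n)%C.
Proof.
  unfold Ctrunc. induction n as [|n IH].
  - rewrite !sum_O. change (PS_incr_1 f 0) with 0. rewrite RtoC_minus. simpl. ring.
  - rewrite !sum_Sn_C, IH, (Cpow_S u (S n)). change (PS_incr_1 f (S n)) with (f n).
    rewrite RtoC_minus. ring.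
Qed.

Definition natural (x : R) : Prop := exists k : nat, x = INR k.

Lemma natural_le_sqr (x : R) : natural x -> x <= x ^ 2.
Proof.
  intros [[|k] ->]; [simpl; lra|]. rewrite S_INR. pose proof (pos_INR k). nra.
Qed.

Lemma natural_PS_mult (f g : nat -> R) :
  (forall n, natural (f n)) -> (forall n, natural (g n)) -> forall n, natural (PS_mult f g n).
Proof.
  intros Hf Hg n. unfold PS_mult.
  assert (Hterm : forall k, natural (f k * g (n - k)%nat)).
  { intros k. destruct (Hf k) as [i ->], (Hg (n - k)%nat) as [j ->].
    exists (i * j)%nat. symmetry. apply mult_INR. }
  generalize n at 2. intros m. induction m as [|m IH]; [apply Hterm|].
  destruct IH as [i Hi], (Hterm (S m)) as [j Hj].
  exists (i + j)%nat. simpl sum_f_R0. rewrite Hi, Hj, plus_INR. reflexivity.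
Qed.

Definition cut (f : nat -> R) (n k : nat) : R := if (k <=? n)%nat then f k else 0.

Lemma Ctrunc_cut (f : nat -> R) m n (u : C) :
  (n <= m)%nat -> Ctrunc (cut f n) m u = Ctrunc f n u.
Proof.
  intros Hnm. unfold Ctrunc. induction Hnm as [|m Hnm IH].
  - apply sum_n_Cext. intros k Hk. unfold cut.
    destruct (Nat.leb_spec k n); [reflexivity | lia].
  - rewrite sum_Sn_C, IH. unfold cut. destruct (Nat.leb_spec (S m) n); [lia | ring].
Qed.

Lemma Ctrunc_mult_cut (f g : nat -> R) m n (u : C) :
  (Ctrunc f m u * Ctrunc g n u = Ctrunc (PS_mult (cut f m) (cut g n)) (m + n) u)%C.
Proof.
  rewrite Ctrunc_PS_mult, <- (Ctrunc_cut f (m + n) m) by lia.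
  rewrite Cmult_comm. unfold Ctrunc at 2. rewrite <- sum_n_Cmult_l.
  apply sum_n_Cext. intros i _. unfold cut at 1 2. destruct (Nat.leb_spec i m).
  - rewrite (Ctrunc_cut g) by lia. ring.
  - ring.
Qed.

Lemma natural_cut (f : nat -> R) n :
  (forall k, natural (f k)) -> forall k, natural (cut f n k).
Proof. intros Hf k. unfold cut. destruct (k <=? n)%nat; [apply Hf | exists O; reflexivity]. Qed.

(** * Parseval's identity on the roots of unity *)

Definition root_of_unity (L : nat) : C := (cos (2 * PI / INR L), sin (2 * PI / INR L)).

Lemma root_of_unity_pow L k :
  (root_of_unity L ^ k)%C = (cos (INR k * (2 * PI / INR L)), sin (INR k * (2 * PI / INR L))).
Proof.
  induction k as [|k IH].
  - simpl. rewrite Rmult_0_l, cos_0, sin_0. reflexivity.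
  - rewrite Cpow_S, IH, S_INR, Rmult_plus_distr_r, Rmult_1_l, cos_plus, sin_plus.
    unfold root_of_unity, Cmult; cbn [fst snd]. f_equal; ring.
Qed.

Lemma Cmod_root_of_unity L : Cmod (root_of_unity L) = 1.
Proof.
  unfold root_of_unity, Cmod; cbn [fst snd]. rewrite <- !Rsqr_pow2, Rplus_comm, sin2_cos2.
  apply sqrt_1.
Qed.

Lemma root_of_unity_pow_order L : (0 < L)%nat -> (root_of_unity L ^ L)%C = 1.
Proof.
  intros HL. apply lt_0_INR in HL. rewrite root_of_unity_pow.
  replace (INR L * (2 * PI / INR L)) with (2 * PI) by (field; lra).
  rewrite cos_2PI, sin_2PI. reflexivity.
Qed.

Lemma root_of_unity_primitive L k : (0 < k < L)%nat -> (root_of_unity L ^ k)%C <> 1.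
Proof.
  intros Hk Heq. rewrite root_of_unity_pow in Heq. injection Heq as Hcos _.
  assert (HkL : 0 < INR k < INR L) by (split; [apply lt_0_INR | apply lt_INR]; lia).
  pose proof PI_RGT_0 as HPI.
  set (t := INR k / INR L * PI).
  assert (Hfrac : 0 < INR k / INR L < 1).
  { split; [apply Rdiv_lt_0_compat; lra|]. apply -> Rdiv_lt_1; lra. }
  assert (Hsin : 0 < sin t) by (apply sin_gt_0; unfold t; nra).
  replace (INR k * (2 * PI / INR L)) with (2 * t) in Hcos by (unfold t; field; lra).
  rewrite cos_2a_sin in Hcos. nra.
Qed.

Lemma sum_n_root_of_unity_pow l k :
  (0 < k <= l)%nat -> sum_n (fun j => (root_of_unity (S l) ^ j) ^ k)%C l = RtoC 0.
Proof.
  intros Hk. set (z := (root_of_unity (S l) ^ k)%C).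
  rewrite (sum_n_Cext _ (fun j => RtoC 1 * z ^ j)%C).
  2:{ intros j _. unfold z. rewrite <- !Cpow_mult_r, Nat.mul_comm. ring. }
  pose proof (Ctrunc_geometric z l) as Hgeo.
  replace (z ^ S l)%C with (RtoC 1) in Hgeo.
  2:{ unfold z. rewrite <- Cpow_mult_r, Nat.mul_comm, Cpow_mult_r, root_of_unity_pow_order by lia.
      symmetry. apply Cpow_1_l. }
  replace (1 - 1)%C with (RtoC 0) in Hgeo by ring.
  assert (Hz : (1 - z)%C <> 0).
  { apply Cminus_eq_contra. apply not_eq_sym, root_of_unity_primitive. lia. }
  destruct (Ceq_dec (Ctrunc (fun _ => 1) l z) 0) as [H0|H0]; [exact H0|].
  exfalso. exact (Cmult_neq_0 _ _ Hz H0 Hgeo).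
Qed.

Lemma Cmod_plus_sqr (z w : C) :
  Cmod (z + w) ^ 2 = Cmod z ^ 2 + Cmod w ^ 2 + 2 * Re (Cconj z * w).
Proof. rewrite !Cmod2_alt. destruct z, w. simpl. ring. Qed.

Lemma Cconj_mult_pow (u : C) k n :
  (k <= n)%nat -> (Cconj u ^ k * u ^ n = RtoC ((Cmod u ^ 2) ^ k) * u ^ (n - k))%C.
Proof.
  intros Hkn. replace n with (k + (n - k))%nat at 1 by lia.
  rewrite Cpow_add_r, Cmult_assoc, <- Cpow_mult_l, (Cmult_comm (Cconj u)), RtoC_pow, Cmod2_conj.
  reflexivity.
Qed.

Section Parseval.

Variables (r : R) (l : nat).
Hypothesis r_ge_0 : 0 <= r.

Let u (j : nat) : C := (r * root_of_unity (S l) ^ j)%C.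

Lemma Cmod_scaled_root_of_unity j : Cmod (u j) = r.
Proof.
  unfold u. rewrite Cmod_mult, Cmod_R, Cmod_pow, Cmod_root_of_unity, pow1, Rabs_pos_eq; lra.
Qed.

Lemma Ctrunc_orthogonal (f : nat -> R) m n :
  (m < n <= l)%nat -> sum_n (fun j => Cconj (Ctrunc f m (u j)) * u j ^ n)%C l = RtoC 0.
Proof.
  intros Hmn.
  transitivity (sum_n (fun j => sum_n (fun k =>
    RtoC (f k * (r ^ 2) ^ k * r ^ (n - k)) * (root_of_unity (S l) ^ j) ^ (n - k))%C m) l).
  - apply sum_n_Cext. intros j _. unfold Ctrunc. rewrite Cconj_sum_n, Cmult_comm, <- sum_n_Cmult_l.
    apply sum_n_Cext. intros k Hk. rewrite Cmult_conj, Cpow_conj.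
    replace (Cconj (f k)) with (RtoC (f k)) by (unfold Cconj, RtoC; simpl; f_equal; ring).
    replace (u j ^ n * (f k * Cconj (u j) ^ k))%C
      with (f k * (Cconj (u j) ^ k * u j ^ n))%C by ring.
    rewrite Cconj_mult_pow, Cmod_scaled_root_of_unity by lia.
    unfold u. rewrite Cpow_mult_l, !RtoC_mult, (RtoC_pow r (n - k)). ring.
  - rewrite sum_n_switch. transitivity (sum_n (fun _ => RtoC 0) m).
    + apply sum_n_Cext. intros k Hk. rewrite sum_n_Cmult_l, sum_n_root_of_unity_pow by lia. ring.
    + exact (sum_n_m_const_zero (G := C_AbelianMonoid) 0 m).
Qed.

Lemma parseval (f : nat -> R) n :
  (n <= l)%nat ->
  sum_n (fun j => Cmod (Ctrunc f n (u j)) ^ 2) l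
  = INR (S l) * trunc (fun k => f k ^ 2) n (r ^ 2) :> R.
Proof.
  intros Hn. induction n as [|n IH].
  - unfold trunc, Ctrunc. rewrite sum_O.
    rewrite (sum_n_Rext _ (fun _ => f O ^ 2 * (r ^ 2) ^ 0)); [apply sum_n_const|].
    intros j _. rewrite sum_O, Cmult_1_r, Cmod_R, pow2_abs. ring.
  - transitivity (sum_n (fun j => Cmod (Ctrunc f n (u j)) ^ 2
      + (f (S n) ^ 2 * (r ^ 2) ^ S n
         + 2 * f (S n) * Re (Cconj (Ctrunc f n (u j)) * u j ^ S n))) l).
    + apply sum_n_Rext. intros j _. unfold Ctrunc at 1. rewrite sum_Sn_C.
      fold (Ctrunc f n (u j)). rewrite Cmod_plus_sqr, Cmod_mult, Cmod_R, Rpow_mult_distr, pow2_abs,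
        Cmod_pow, Cmod_scaled_root_of_unity, <- !pow_mult, (Nat.mul_comm (S n) 2).
      replace (Cconj (Ctrunc f n (u j)) * (f (S n) * u j ^ S n))%C
        with (f (S n) * (Cconj (Ctrunc f n (u j)) * u j ^ S n))%C by ring.
      rewrite re_scal_l. ring.
    + rewrite !sum_n_Rplus, IH, sum_n_const, sum_n_Rmult_l, <- Re_sum_n, Ctrunc_orthogonal by lia.
      unfold trunc. rewrite sum_Sn_R. simpl Re. ring.
Qed.

End Parseval.

(** * The averaged inequality *)

(* For [P = 1 + u + ... + u ^ m] one has [(1 - u) P = 1 - u ^ (m + 1)], so the factor [|P| ^ 2]
   costs only one factor [|P|] on the error term, which is split by
   [2 |E| |P| <= tau |P| ^ 2 + |E| ^ 2 / tau]. *)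
Lemma Cmod_mult_sqr_le (P A B E u : C) (tau D : R) :
  0 < tau -> Cmod ((1 - u) * P) <= 2 -> Cmod (A ^ 2 - B ^ 2 - (1 - u) * E) <= D ->
  Cmod (P * A) ^ 2
  <= Cmod P ^ 2 * Cmod B ^ 2 + (tau * Cmod P ^ 2 + / tau * Cmod E ^ 2) + Cmod P ^ 2 * D.
Proof.
  intros Htau HuP HD. rewrite Cmod_mult in HuP.
  pose proof (Cmod_ge_0 P) as HP. pose proof (Cmod_ge_0 E) as HE.
  set (Delta := (A ^ 2 - B ^ 2 - (1 - u) * E)%C) in *.
  assert (HA : Cmod A ^ 2 <= Cmod B ^ 2 + Cmod (1 - u) * Cmod E + D).
  { rewrite <- !Cmod_pow, <- Cmod_mult.
    replace (A ^ 2)%C with (B ^ 2 + (1 - u) * E + Delta)%C by (unfold Delta; ring).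
    pose proof (Cmod_triangle (B ^ 2 + (1 - u) * E) Delta).
    pose proof (Cmod_triangle (B ^ 2) ((1 - u) * E)). lra. }
  assert (Herror : Cmod P ^ 2 * (Cmod (1 - u) * Cmod E) <= 2 * (Cmod E * Cmod P)).
  { replace (Cmod P ^ 2 * (Cmod (1 - u) * Cmod E)) with (Cmod (1 - u) * Cmod P * (Cmod E * Cmod P))
      by ring.
    apply Rmult_le_compat_r; [nra | assumption]. }
  assert (Hamgm : 2 * (Cmod E * Cmod P) <= tau * Cmod P ^ 2 + / tau * Cmod E ^ 2).
  { apply Rminus_le_0.
    replace (_ - _) with (tau * (Cmod P - / tau * Cmod E) ^ 2) by (field; lra).
    apply Rmult_le_pos; [lra | apply pow2_ge_0]. }
  rewrite Cmod_mult, Rpow_mult_distr.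
  apply Rle_trans with (Cmod P ^ 2 * (Cmod B ^ 2 + Cmod (1 - u) * Cmod E + D)); [|lra].
  apply Rmult_le_compat_l; [apply pow2_ge_0 | exact HA].
Qed.

Lemma Cmod_geometric_sqr_le (u : C) m :
  Cmod (Ctrunc (fun _ => 1) m u) ^ 2 <= INR (S m) * trunc (fun _ => 1) m (Cmod u ^ 2).
Proof.
  apply Rle_trans with (trunc (fun _ => 1) m (Cmod u) ^ 2).
  - apply pow_incr. split; [apply Cmod_ge_0|].
    eapply Rle_trans; [apply Cmod_Ctrunc_le|]. right.
    apply sum_n_Rext. intros k _. rewrite Rabs_R1. reflexivity.
  - unfold trunc.
    rewrite (sum_n_Rext _ (fun k => 1 * (1 * Cmod u ^ k))) by (intros; ring).
    eapply Rle_trans; [apply cauchy_schwarz_sum_n; intros; lra|]. right. f_equal.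
    + rewrite (sum_n_Rext _ (fun _ => 1)) by (intros; ring). rewrite sum_n_const. apply Rmult_1_r.
    + apply sum_n_Rext. intros k _. rewrite <- !pow_mult, (Nat.mul_comm 2). reflexivity.
Qed.

Lemma trunc_one_le (x : R) m : 0 <= x <= 1 -> trunc (fun _ => 1) m x <= INR (S m).
Proof.
  intros Hx. rewrite <- (Rmult_1_r (INR (S m))), <- sum_n_const. apply sum_n_le.
  intros k _. rewrite Rmult_1_l. apply pow_le_1, Hx.
Qed.

Lemma geometric_trunc_le_mean_sqr (a : nat -> R) (m n : nat) (r : R) :
  let u j := (RtoC r * root_of_unity (S (m + n)) ^ j)%C in
  (forall k, natural (a k)) -> 0 <= r ->
  INR (S (m + n)) * (trunc (fun _ => 1) m (r ^ 2) * trunc a n (r ^ 2))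
  <= sum_n (fun j => Cmod (Ctrunc (fun _ => 1) m (u j) * Ctrunc a n (u j)) ^ 2) (m + n).
Proof.
  intros u Ha Hr. set (c := PS_mult (cut (fun _ => 1) m) (cut a n)).
  assert (Hc : forall k, natural (c k)).
  { apply natural_PS_mult; apply natural_cut; [intros _; exists 1%nat; reflexivity | exact Ha]. }
  rewrite (sum_n_Rext _ (fun j => Cmod (Ctrunc c (m + n) (u j)) ^ 2))
    by (intros j _; rewrite Ctrunc_mult_cut; reflexivity).
  unfold u. rewrite parseval by (assumption || lia).
  apply Rmult_le_compat_l; [apply pos_INR|].
  replace (trunc (fun _ => 1) m (r ^ 2) * trunc a n (r ^ 2)) with (trunc c (m + n) (r ^ 2)).
  - apply sum_n_le. intros k _. apply Rmult_le_compat_r.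
    + apply pow_le, pow2_ge_0.
    + apply natural_le_sqr, Hc.
  - apply RtoC_inj. rewrite RtoC_mult, <- !Ctrunc_RtoC. symmetry. apply Ctrunc_mult_cut.
Qed.

Lemma Cmod_geometric_mult_sqr_le (A B E u : C) (m : nat) (tau D : R) :
  Cmod u <= 1 -> 0 < tau -> Cmod (A ^ 2 - B ^ 2 - (1 - u) * E) <= D ->
  let P := Ctrunc (fun _ => 1) m u in
  Cmod (P * A) ^ 2
  <= INR (S m) * trunc (fun _ => 1) m (Cmod u ^ 2) * Cmod B ^ 2
     + (tau * Cmod P ^ 2 + / tau * Cmod E ^ 2)
     + INR (S m) ^ 2 * D.
Proof.
  intros Hu Htau HD P. pose proof (Cmod_ge_0 u) as Hu0.
  assert (HD0 : 0 <= D) by (eapply Rle_trans; [apply Cmod_ge_0 | exact HD]).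
  pose proof (Cmod_geometric_sqr_le u m) as HP. fold P in HP.
  assert (Hone : trunc (fun _ => 1) m (Cmod u ^ 2) <= INR (S m)) by (apply trunc_one_le; nra).
  assert (HPM : Cmod P ^ 2 <= INR (S m) ^ 2).
  { eapply Rle_trans; [exact HP|].
    replace (INR (S m) ^ 2) with (INR (S m) * INR (S m)) by ring.
    apply Rmult_le_compat_l; [apply pos_INR | exact Hone]. }
  assert (HuP : Cmod ((1 - u) * P) <= 2).
  { unfold P. rewrite Ctrunc_geometric. eapply Rle_trans; [apply Cmod_triangle|].
    rewrite Cmod_1, Cmod_opp, Cmod_pow. pose proof (pow_le_1 (Cmod u) (S m) ltac:(lra)). lra. }
  eapply Rle_trans; [apply (Cmod_mult_sqr_le P A B E u tau D Htau HuP HD)|].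
  pose proof (Rmult_le_compat_r _ _ _ HD0 HPM).
  pose proof (Rmult_le_compat_r _ _ _ (pow2_ge_0 (Cmod B)) HP). lra.
Qed.

Lemma trunc_averaged_inequality (a b e : nat -> R) (m n : nat) (r tau D : R) :
  (forall k, natural (a k)) -> 0 <= r <= 1 -> 0 < tau ->
  (forall u, Cmod u = r ->
     Cmod (Ctrunc a n u ^ 2 - Ctrunc b n u ^ 2 - (1 - u) * Ctrunc e n u) <= D) ->
  let P := trunc (fun _ => 1) m (r ^ 2) in
  P * trunc a n (r ^ 2)
  <= INR (S m) * P * trunc (fun k => b k ^ 2) n (r ^ 2)
     + (tau * P + / tau * trunc (fun k => e k ^ 2) n (r ^ 2))
     + INR (S m) ^ 2 * D.
Proof.
  intros Ha Hr Htau HD P.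
  set (L := S (m + n)). set (u := fun j => (RtoC r * root_of_unity L ^ j)%C).
  assert (Hu : forall j, Cmod (u j) = r) by (intros; apply Cmod_scaled_root_of_unity; lra).
  apply Rmult_le_reg_l with (INR L); [apply lt_0_INR; unfold L; lia|].
  eapply Rle_trans; [apply geometric_trunc_le_mean_sqr; [exact Ha | lra]|].
  eapply Rle_trans.
  { apply sum_n_le. intros j _. fold L. fold (u j).
    apply (Cmod_geometric_mult_sqr_le _ (Ctrunc b n (u j)) (Ctrunc e n (u j)) (u j) m tau D).
    - rewrite Hu. lra.
    - exact Htau.
    - apply HD, Hu. }
  rewrite (sum_n_Rext _ (fun j => INR (S m) * P * Cmod (Ctrunc b n (u j)) ^ 2
    + (tau * Cmod (Ctrunc (fun _ => 1) m (u j)) ^ 2 + / tau * Cmod (Ctrunc e n (u j)) ^ 2)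
    + INR (S m) ^ 2 * D)) by (intros j _; rewrite Hu; reflexivity).
  unfold u, L. rewrite !sum_n_Rplus, !sum_n_Rmult_l, sum_n_const, !parseval by (lra || lia).
  replace (trunc (fun _ => 1 ^ 2) m (r ^ 2)) with P by (apply sum_n_Rext; intros; ring).
  right. ring.
Qed.

(** * Power series *)

Lemma Rabs_lt_CV_radius (rho : R) (f : nat -> R) (x : R) :
  Rbar_le rho (CV_radius f) -> 0 <= x < rho -> Rbar_lt (Rabs x) (CV_radius f).
Proof.
  intros Hf Hx. apply Rbar_lt_le_trans with rho; [|exact Hf].
  rewrite Rabs_pos_eq; simpl; lra.
Qed.

Lemma ex_pseries_in_disk (rho : R) (f : nat -> R) (x : R) :
  Rbar_le rho (CV_radius f) -> 0 <= x < rho -> ex_pseries f x.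
Proof. intros Hf Hx. apply CV_radius_inside, (Rabs_lt_CV_radius rho); assumption. Qed.

Lemma CV_radius_ge_of_ex_pseries (f : nat -> R) (rho : R) :
  (forall x, 0 <= x < rho -> ex_pseries f x) -> Rbar_le rho (CV_radius f).
Proof.
  intros Hf. apply Rbar_not_lt_le. intros Hlt.
  pose proof (CV_radius_ge_0 f) as H0. pose proof (CV_disk_outside f) as Hout.
  destruct (CV_radius f) as [c| |]; simpl in *; try easy.
  apply (Hout ((c + rho) / 2)); [rewrite Rabs_pos_eq; lra|].
  apply ex_series_lim_0, ex_pseries_R, Hf. lra.
Qed.

Lemma CV_radius_ge_1_of_eventually_bounded (f : nat -> R) (M : R) n0 :
  (forall n, (n0 <= n)%nat -> Rabs (f n) <= M) -> Rbar_le 1 (CV_radius f).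
Proof.
  intros Hf. apply (CV_radius_bounded f). exists (psum (fun k => Rabs (f k)) n0 + Rabs M).
  intros n. rewrite pow1, Rmult_1_r. pose proof (Rabs_pos M).
  destruct (Nat.le_gt_cases n n0) as [Hn|Hn].
  - pose proof (psum_ge_term (fun k => Rabs (f k)) n n0 (fun k => Rabs_pos (f k)) Hn). lra.
  - pose proof (psum_nonneg (fun k => Rabs (f k)) n0 (fun k => Rabs_pos (f k))).
    pose proof (Rle_abs M). specialize (Hf n ltac:(lia)). lra.
Qed.

Lemma CV_radius_Rabs (f : nat -> R) : CV_radius (fun k => Rabs (f k)) = CV_radius f.
Proof.
  apply Lub_Rbar_eqset. intros r.
  assert (Hterm : forall n, Rabs (Rabs (f n) * r ^ n) = Rabs (f n * r ^ n))
    by (intros n; rewrite !Rabs_mult, Rabs_Rabsolu; reflexivity).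
  split; apply ex_series_ext; intros n; [|symmetry]; apply Hterm.
Qed.

Lemma CV_radius_PS_mult_ge (f g : nat -> R) (rho : R) :
  Rbar_le rho (CV_radius f) -> Rbar_le rho (CV_radius g) -> Rbar_le rho (CV_radius (PS_mult f g)).
Proof.
  intros Hf Hg. apply CV_radius_ge_of_ex_pseries. intros x Hx.
  apply ex_pseries_mult; apply (Rabs_lt_CV_radius rho); assumption.
Qed.

Lemma CV_radius_psum_ge_1 (f : nat -> R) :
  Rbar_le 1 (CV_radius f) -> Rbar_le 1 (CV_radius (psum f)).
Proof.
  intros Hf. rewrite (CV_radius_ext _ (PS_mult f (fun _ => 1))).
  - apply CV_radius_PS_mult_ge; [exact Hf|].
    apply CV_radius_ge_1_of_eventually_bounded with 1 O. intros _ _. rewrite Rabs_R1. lra.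
  - intros n. unfold PS_mult, psum. apply sum_eq. intros. ring.
Qed.

Lemma ex_pseries_sqr (f : nat -> R) (r : R) :
  Rbar_lt (Rabs r) (CV_radius f) -> ex_pseries (fun k => f k ^ 2) (r ^ 2).
Proof.
  intros Hr. apply CV_disk_inside in Hr. apply ex_pseries_R.
  destruct (filterlim_bounded (fun n => Rabs (f n * r ^ n))) as [M HM].
  { exists 0. exact (ex_series_lim_0 _ Hr). }
  apply (ex_series_le (K := R_AbsRing) (V := R_CompleteNormedModule) _
    (fun n => M * Rabs (f n * r ^ n))).
  - intros n. specialize (HM n). change norm with Rabs in *. rewrite Rabs_Rabsolu in HM.
    replace (f n ^ 2 * (r ^ 2) ^ n) with ((f n * r ^ n) * (f n * r ^ n))
      by (rewrite <- pow_mult, Nat.mul_comm, pow_mult; ring).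
    rewrite Rabs_mult. apply Rmult_le_compat_r; [apply Rabs_pos | exact HM].
  - exact (ex_series_scal (K := R_AbsRing) (V := R_NormedModule) M _ Hr).
Qed.

Lemma sqrt_lt_1_of_lt_1 (x : R) : 0 <= x < 1 -> 0 <= sqrt x < 1.
Proof.
  intros Hx. split; [apply sqrt_pos|]. rewrite <- sqrt_1. apply sqrt_lt_1; lra.
Qed.

Lemma ex_pseries_sqr_unit_disk (f : nat -> R) (x : R) :
  Rbar_le 1 (CV_radius f) -> 0 <= x < 1 -> ex_pseries (fun k => f k ^ 2) x.
Proof.
  intros Hf Hx. rewrite <- (pow2_sqrt x) by lra.
  apply ex_pseries_sqr, (Rabs_lt_CV_radius 1), sqrt_lt_1_of_lt_1; assumption.
Qed.

Lemma is_lim_seq_trunc (f : nat -> R) (x : R) :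
  ex_pseries f x -> is_lim_seq (fun n => trunc f n x) (PSeries f x).
Proof. intros Hf. apply Series_correct, ex_pseries_R, Hf. Qed.

Lemma is_lim_seq_mult_defect (f g : nat -> R) (x : R) :
  Rbar_lt (Rabs x) (CV_radius f) -> Rbar_lt (Rabs x) (CV_radius g) ->
  is_lim_seq (fun n => mult_defect f g n x) 0.
Proof.
  intros Hf Hg. rewrite <- (Rminus_diag (PSeries f x * PSeries g x)).
  rewrite <- (PSeries_mult f g x) at 2 by assumption.
  apply is_lim_seq_minus'; [apply is_lim_seq_mult'|]; apply is_lim_seq_trunc.
  - apply CV_radius_inside, Hf.
  - apply CV_radius_inside, Hg.
  - apply ex_pseries_mult; assumption.
Qed.

Lemma trunc_le_PSeries (f : nat -> R) (x : R) n :
  ex_pseries f x -> 0 <= x -> (forall k, (n < k)%nat -> 0 <= f k) -> trunc f n x <= PSeries f x.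
Proof.
  intros Hf Hx Hpos.
  apply (is_lim_seq_le_loc (fun _ => trunc f n x) (fun m => trunc f m x)
           (trunc f n x) (PSeries f x)).
  - exists n. intros m Hm. apply sum_n_le_index; [exact Hm|]. intros k Hk.
    apply Rmult_le_pos; [apply Hpos; lia | apply pow_le, Hx].
  - apply is_lim_seq_const.
  - apply is_lim_seq_trunc, Hf.
Qed.

Lemma PSeries_nonneg (f : nat -> R) (x : R) :
  ex_pseries f x -> 0 <= x -> (forall k, 0 <= f k) -> 0 <= PSeries f x.
Proof.
  intros Hf Hx Hpos. apply Rle_trans with (trunc f O x).
  - apply trunc_nonneg; assumption.
  - apply trunc_le_PSeries; auto.
Qed.

Lemma PSeries_cauchy_schwarz (f : nat -> R) (x : R) :
  ex_pseries f x -> ex_pseries (fun k => f k ^ 2) x -> 0 <= x < 1 ->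
  (1 - x) * PSeries f x ^ 2 <= PSeries (fun k => f k ^ 2) x.
Proof.
  intros Hf Hf2 Hx.
  apply (is_lim_seq_le (fun n => (1 - x) * trunc f n x ^ 2) (fun n => trunc (fun k => f k ^ 2) n x)
    ((1 - x) * PSeries f x ^ 2) (PSeries (fun k => f k ^ 2) x)).
  - intros n.
    assert (HCS : trunc f n x ^ 2 <= trunc (fun k => f k ^ 2) n x * trunc (fun _ => 1) n x).
    { unfold trunc.
      rewrite (sum_n_Rext (fun k => f k * x ^ k) (fun k => x ^ k * (f k * 1))) by (intros; ring).
      eapply Rle_trans; [apply cauchy_schwarz_sum_n; intros; apply pow_le; lra|].
      right. f_equal; apply sum_n_Rext; intros; ring. }
    pose proof (trunc_geometric x n) as Hgeo.
    assert (Hpow : 0 <= x ^ S n) by (apply pow_le; lra).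
    assert (Hpos : 0 <= trunc (fun k => f k ^ 2) n x)
      by (apply trunc_nonneg; [intros; apply pow2_ge_0 | lra]).
    apply Rle_trans with ((1 - x) * (trunc (fun k => f k ^ 2) n x * trunc (fun _ => 1) n x)).
    + apply Rmult_le_compat_l; [lra | exact HCS].
    + replace ((1 - x) * _) with (trunc (fun k => f k ^ 2) n x * (1 - x ^ S n))
        by (rewrite <- Hgeo; ring).
      nra.
  - apply (is_lim_seq_scal_l _ (1 - x) (PSeries f x ^ 2)).
    replace (PSeries f x ^ 2) with (PSeries f x * PSeries f x) by ring.
    apply is_lim_seq_ext with (fun n => trunc f n x * trunc f n x); [intros; ring|].
    apply is_lim_seq_mult'; apply is_lim_seq_trunc, Hf.
  - apply is_lim_seq_trunc, Hf2.
Qed.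

Lemma PSeries_cauchy_schwarz_unit_disk (f : nat -> R) (x : R) :
  Rbar_le 1 (CV_radius f) -> 0 <= x < 1 ->
  (1 - x) * PSeries f x ^ 2 <= PSeries (fun k => f k ^ 2) x.
Proof.
  intros Hf Hx. apply PSeries_cauchy_schwarz; [| |exact Hx].
  - apply (ex_pseries_in_disk 1); assumption.
  - apply ex_pseries_sqr_unit_disk; assumption.
Qed.

Definition psum_square_identity (a b e : nat -> R) : Prop :=
  forall n, psum (PS_mult a a) n = psum (PS_mult b b) n + e n.

Section Error_term.

Variables a b e : nat -> R.
Hypothesis radius_a : Rbar_le 1 (CV_radius a).
Hypothesis radius_b : Rbar_le 1 (CV_radius b).
Hypothesis identity : psum_square_identity a b e.

Lemma CV_radius_error : Rbar_le 1 (CV_radius e).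
Proof.
  apply CV_radius_ge_of_ex_pseries. intros x Hx.
  apply ex_pseries_ext with (PS_minus (psum (PS_mult a a)) (psum (PS_mult b b))).
  - intros n. unfold PS_minus, PS_plus, PS_opp. rewrite identity.
    unfold plus, opp; simpl. ring.
  - apply ex_pseries_minus;
      apply (ex_pseries_in_disk 1), Hx;
      apply CV_radius_psum_ge_1, CV_radius_PS_mult_ge; assumption.
Qed.

Lemma PS_mult_self_identity n : PS_mult a a n = PS_mult b b n + (e n - PS_incr_1 e n).
Proof.
  destruct n as [|n].
  - change (PS_incr_1 e 0) with 0. pose proof (identity O) as H0.
    unfold psum in H0. simpl sum_f_R0 in H0. lra.
  - change (PS_incr_1 e (S n)) with (e n).
    pose proof (identity n) as Hn. pose proof (identity (S n)) as HSn.
    unfold psum in *. simpl sum_f_R0 in HSn. lra.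
Qed.

Lemma PSeries_sqr_identity x :
  0 <= x < 1 -> PSeries a x ^ 2 = PSeries b x ^ 2 + (1 - x) * PSeries e x.
Proof.
  intros Hx. pose proof CV_radius_error as radius_e.
  assert (ex_b : ex_pseries (PS_mult b b) x)
    by (apply ex_pseries_mult; apply (Rabs_lt_CV_radius 1); assumption).
  assert (ex_e : ex_pseries e x) by (apply (ex_pseries_in_disk 1); assumption).
  assert (ex_e' : ex_pseries (PS_incr_1 e) x) by apply ex_pseries_incr_1, ex_e.
  replace (PSeries a x ^ 2) with (PSeries (PS_mult a a) x)
    by (rewrite PSeries_mult by (apply (Rabs_lt_CV_radius 1); assumption); ring).
  rewrite (PSeries_ext _ (PS_plus (PS_mult b b) (PS_minus e (PS_incr_1 e))))
    by apply PS_mult_self_identity.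
  rewrite PSeries_plus, PSeries_minus, PSeries_incr_1, PSeries_mult
    by (try apply ex_pseries_minus; try apply (Rabs_lt_CV_radius 1); assumption).
  ring.
Qed.

Definition truncation_error (n : nat) (r : R) : R :=
  mult_defect (fun k => Rabs (a k)) (fun k => Rabs (a k)) n r
  + mult_defect (fun k => Rabs (b k)) (fun k => Rabs (b k)) n r
  + Rabs (e n) * r ^ S n.

Lemma Cmod_truncated_identity_le n (u : C) :
  Cmod (Ctrunc a n u ^ 2 - Ctrunc b n u ^ 2 - (1 - u) * Ctrunc e n u)
  <= truncation_error n (Cmod u).
Proof.
  set (da := (Ctrunc a n u * Ctrunc a n u - Ctrunc (PS_mult a a) n u)%C).
  set (db := (Ctrunc b n u * Ctrunc b n u - Ctrunc (PS_mult b b) n u)%C).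
  assert (Hcoef : Ctrunc (PS_mult a a) n u
    = (Ctrunc (PS_mult b b) n u + ((1 - u) * Ctrunc e n u + e n * u ^ S n))%C).
  { rewrite <- Ctrunc_backward_difference. unfold Ctrunc. rewrite <- sum_n_Cplus.
    apply sum_n_Cext. intros k _. rewrite PS_mult_self_identity, RtoC_plus. ring. }
  replace (_ - _)%C with (da + - db + e n * u ^ S n)%C by (unfold da, db; rewrite Hcoef; ring).
  pose proof (Cmod_Ctrunc_mult_defect_le a a n u : Cmod da <= _) as Ha.
  pose proof (Cmod_Ctrunc_mult_defect_le b b n u : Cmod db <= _) as Hb.
  pose proof (Cmod_triangle (da + - db) (e n * u ^ S n)) as Htri.
  pose proof (Cmod_triangle da (- db)) as Htri'.
  rewrite Cmod_mult, Cmod_R, Cmod_pow in Htri. rewrite Cmod_opp in Htri'.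
  unfold truncation_error. lra.
Qed.

Lemma is_lim_seq_truncation_error r : 0 <= r < 1 -> is_lim_seq (fun n => truncation_error n r) 0.
Proof.
  intros Hr. replace 0 with (0 + 0 + r * 0) by ring.
  apply is_lim_seq_plus'; [apply is_lim_seq_plus'|].
  - apply is_lim_seq_mult_defect; rewrite CV_radius_Rabs; apply (Rabs_lt_CV_radius 1); assumption.
  - apply is_lim_seq_mult_defect; rewrite CV_radius_Rabs; apply (Rabs_lt_CV_radius 1); assumption.
  - apply is_lim_seq_ext with (fun n => r * Rabs (e n * r ^ n)).
    + intros n. rewrite Rabs_mult, (Rabs_pos_eq (r ^ n)) by (apply pow_le; lra). simpl. ring.
    + apply (is_lim_seq_scal_l _ r 0), ex_series_lim_0, CV_disk_inside, (Rabs_lt_CV_radius 1), Hr.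
      apply CV_radius_error.
Qed.

Lemma PSeries_averaged_inequality (m : nat) (r tau : R) :
  (forall k, natural (a k)) -> 0 <= r < 1 -> 0 < tau ->
  let P := trunc (fun _ => 1) m (r ^ 2) in
  P * PSeries a (r ^ 2)
  <= INR (S m) * P * PSeries (fun k => b k ^ 2) (r ^ 2)
     + (tau * P + / tau * PSeries (fun k => e k ^ 2) (r ^ 2)).
Proof.
  intros Ha Hr Htau P. pose proof CV_radius_error as radius_e.
  assert (Hr2 : 0 <= r ^ 2 < 1) by nra.
  rewrite <- (Rplus_0_r (_ + (_ + _))), <- (Rmult_0_r (INR (S m) ^ 2)).
  eapply (is_lim_seq_le _ _ (Finite _) (Finite _)).
  - intros n. apply (trunc_averaged_inequality a b e m n r tau (truncation_error n r) Ha);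
      [lra | exact Htau|].
    intros u <-. apply Cmod_truncated_identity_le.
  - apply (is_lim_seq_scal_l _ P (PSeries a (r ^ 2))), is_lim_seq_trunc,
      (ex_pseries_in_disk 1); assumption.
  - apply is_lim_seq_plus'; [apply is_lim_seq_plus'; [|apply is_lim_seq_plus']|].
    + eapply (is_lim_seq_scal_l _ _ (Finite _)), is_lim_seq_trunc, ex_pseries_sqr_unit_disk;
        assumption.
    + apply is_lim_seq_const.
    + eapply (is_lim_seq_scal_l _ _ (Finite _)), is_lim_seq_trunc, ex_pseries_sqr_unit_disk;
        assumption.
    + apply (is_lim_seq_scal_l _ _ 0), is_lim_seq_truncation_error, Hr.
Qed.

End Error_term.

(** * Transfer from partial sums to power series *)

Lemma at_left_interval (y z : R) : y < z -> at_left z (fun x => y < x < z).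
Proof.
  intros Hyz. unfold at_left, within.
  apply (filter_imp (fun x => y < x)); [intros; split; assumption|].
  apply (open_gt y z Hyz).
Qed.

Lemma at_left_1_pow_gt (s : R) n : s < 1 -> at_left 1 (fun x => s < x ^ n).
Proof.
  intros Hs.
  assert (Hcont : continuous (fun x : R => x ^ n) 1)
    by (apply (ex_derive_continuous (K := R_AbsRing) (V := R_NormedModule)); auto_derive; exact I).
  apply filter_le_within. apply (Hcont (fun y => s < y)).
  apply (open_gt s). rewrite pow1. exact Hs.
Qed.

Lemma least_index (P : nat -> Prop) :
  (exists n, P n) -> exists n, P n /\ forall k, (k < n)%nat -> ~ P k.
Proof.
  intros HP.
  destruct (Wf_nat.dec_inh_nat_subset_has_unique_least_element P (fun n => classic (P n)) HP)
    as [n [[Hn Hleast] _]].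
  exists n. split; [exact Hn|]. intros k Hk HPk. specialize (Hleast k HPk). lia.
Qed.

Lemma at_left_1_exists_pow (s : R) n0 :
  0 < s < 1 -> at_left 1 (fun x => exists n, (n0 <= n)%nat /\ s / 2 <= x ^ n <= s).
Proof.
  intros Hs.
  apply (filter_imp (fun x => / 2 < x < 1 /\ s < x ^ n0)).
  2:{ apply filter_and; [apply at_left_interval; lra | apply at_left_1_pow_gt; lra]. }
  intros x [Hx Hn0].
  destruct (least_index (fun n => x ^ n <= s)) as [n [Hn Hleast]].
  { destruct (pow_lt_1_zero x) with (y := s) as [n Hn]; [rewrite Rabs_pos_eq; lra | lra|].
    exists n. specialize (Hn n (le_n n)). apply Rabs_def2 in Hn. lra. }
  exists n. repeat split; [| |exact Hn].
  - apply Nat.lt_le_incl, Nat.nle_gt. intros Hle.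
    pose proof (pow_antitone x n n0 ltac:(lra) Hle). lra.
  - destruct n as [|n]; [simpl in *; lra|].
    specialize (Hleast n (Nat.lt_succ_diag_r n)). apply Rnot_le_lt in Hleast.
    simpl. nra.
Qed.

Lemma sum_n_weighted_ge (f w : nat -> R) n0 n :
  (forall k, (n0 <= k)%nat -> 0 <= f k) -> (forall k, (k <= n)%nat -> 0 <= w k <= 1) ->
  - psum (fun k => Rabs (f k)) n0 <= sum_n (fun k => f k * w k) n.
Proof.
  intros Hf Hw. set (m := Nat.min n n0).
  apply Rle_trans with (sum_n (fun k => f k * w k) m).
  - apply Rle_trans with (- psum (fun k => Rabs (f k)) m).
    + apply Ropp_le_contravar, psum_monotone with O; [intros; apply Rabs_pos | lia].
    + rewrite psum_sum_n. replace (- _) with (-1 * sum_n (fun k => Rabs (f k)) m) by ring.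
      rewrite <- sum_n_Rmult_l. apply sum_n_le. intros k Hk. specialize (Hw k ltac:(lia)).
      unfold Rabs. destruct (Rcase_abs (f k)); nra.
  - apply sum_n_le_index; [lia|]. intros k Hk. apply Rmult_le_pos; [apply Hf | apply Hw]; lia.
Qed.

Lemma PSeries_ge_of_eventually_nonneg (f : nat -> R) n0 (x : R) :
  ex_pseries f x -> 0 <= x <= 1 -> (forall k, (n0 <= k)%nat -> 0 <= f k) ->
  - psum (fun k => Rabs (f k)) n0 <= PSeries f x.
Proof.
  intros Hex Hx Hf. apply Rle_trans with (trunc f n0 x).
  - apply sum_n_weighted_ge; [exact Hf|]. intros k _.
    split; [apply pow_le; lra | apply pow_le_1, Hx].
  - apply trunc_le_PSeries; [exact Hex | lra|]. intros; apply Hf; lia.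
Qed.

Lemma PSeries_sqr_le (f : nat -> R) (rho : R) n0 (x : R) :
  (forall k, (n0 <= k)%nat -> 0 <= f k <= rho) -> 0 <= x <= 1 ->
  ex_pseries f x -> ex_pseries (fun k => f k ^ 2) x ->
  PSeries (fun k => f k ^ 2) x
  <= rho * PSeries f x + psum (fun k => Rabs (rho * f k - f k ^ 2)) n0.
Proof.
  intros Hf Hx Hex Hex2.
  assert (Hscal : ex_pseries (PS_scal rho f) x)
    by (apply ex_pseries_scal; [apply Rmult_comm | exact Hex]).
  assert (Hdiff : ex_pseries (PS_minus (PS_scal rho f) (fun k => f k ^ 2)) x)
    by (apply ex_pseries_minus; assumption).
  pose proof (PSeries_ge_of_eventually_nonneg _ n0 x Hdiff Hx) as Hge.
  rewrite PSeries_minus, PSeries_scal in Hge by assumption.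
  enough (- psum (fun k => Rabs (rho * f k - f k ^ 2)) n0
          <= rho * PSeries f x - PSeries (fun k => f k ^ 2) x) by lra.
  apply Hge. intros k Hk. specialize (Hf k Hk). change (0 <= rho * f k - f k ^ 2). nra.
Qed.

Lemma PSeries_ge_psum (f : nat -> R) n0 n (x : R) :
  ex_pseries f x -> 0 <= x <= 1 -> (forall k, (n0 <= k)%nat -> 0 <= f k) -> (n0 <= n)%nat ->
  x ^ n * psum f n - psum (fun k => Rabs (f k)) n0 <= PSeries f x.
Proof.
  intros Hex Hx Hf Hn. apply Rle_trans with (trunc f n x).
  - pose proof (sum_n_weighted_ge f (fun k => x ^ k - x ^ n) n0 n Hf) as Hge.
    rewrite (sum_n_Rext _ (fun k => f k * x ^ k + (- x ^ n) * f k)) in Hge by (intros; ring).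
    rewrite sum_n_Rplus, sum_n_Rmult_l, <- (psum_sum_n f n) in Hge. fold (trunc f n x) in Hge.
    assert (- psum (fun k => Rabs (f k)) n0 <= trunc f n x + - x ^ n * psum f n); [|lra].
    apply Hge. intros k Hk.
    pose proof (pow_antitone x k n Hx Hk). pose proof (pow_le_1 x k Hx).
    pose proof (pow_le x n ltac:(lra)). lra.
  - apply trunc_le_PSeries; [exact Hex | lra|]. intros; apply Hf; lia.
Qed.

Lemma trunc_block_bound (f : nat -> R) (x : R) N k :
  (forall n, 0 <= f n) -> 0 <= x <= 1 ->
  trunc f ((k + 1) * N) x <= sum_n (fun j => (x ^ N) ^ j * psum f ((j + 1) * N)) k.
Proof.
  intros Hf Hx. induction k as [|k IH].
  - rewrite sum_O. simpl pow. rewrite Rmult_1_l, psum_sum_n. apply sum_n_le. intros k _.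
    rewrite <- (Rmult_1_r (f k)) at 2. apply Rmult_le_compat_l; [apply Hf | apply pow_le_1, Hx].
  - rewrite sum_Sn_R.
    assert (Hblock : trunc f ((S k + 1) * N) x - trunc f ((k + 1) * N) x
      <= (x ^ N) ^ S k * (psum f ((S k + 1) * N) - psum f ((k + 1) * N))).
    { rewrite !psum_sum_n, Rmult_minus_distr_l, <- !sum_n_Rmult_l.
      apply sum_n_increment_le; [lia|]. intros j Hj. rewrite Rmult_comm.
      apply Rmult_le_compat_r; [apply Hf|].
      rewrite <- pow_mult. apply pow_antitone; [exact Hx | lia]. }
    assert (0 <= (x ^ N) ^ S k * psum f ((k + 1) * N))
      by (apply Rmult_le_pos; [apply pow_le, pow_le; lra | apply psum_nonneg, Hf]).
    lra.
Qed.

Lemma sum_n_pow_le_2 (y : R) n : 0 <= y <= / 2 -> sum_n (pow y) n <= 2.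
Proof.
  intros Hy. pose proof (trunc_geometric y n) as Hgeo. unfold trunc in Hgeo.
  rewrite (sum_n_Rext _ (pow y)) in Hgeo by (intros; ring).
  assert (0 <= y ^ S n) by (apply pow_le; lra).
  assert (0 <= sum_n (pow y) n) by (apply sum_n_nonneg; intros; apply pow_le; lra).
  nra.
Qed.

Lemma weighted_sums_product_le (G H : nat -> R) (q D Z : R) n :
  0 <= q -> 0 <= D -> q * D <= / 2 -> 0 <= Z ->
  (forall k l, G k * H l <= Z * D ^ (k + l)) ->
  sum_n (fun k => q ^ k * G k) n * sum_n (fun l => q ^ l * H l) n <= 4 * Z.
Proof.
  intros Hq HD HqD HZ HGH.
  set (y := q * D).
  assert (Hgeo : sum_n (pow y) n <= 2) by (apply sum_n_pow_le_2; unfold y; nra).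
  set (SH := sum_n (fun l => q ^ l * H l) n).
  assert (Hk : forall k, G k * SH <= 2 * Z * D ^ k).
  { intros k. unfold SH. rewrite <- sum_n_Rmult_l.
    apply Rle_trans with (sum_n (fun l => Z * D ^ k * y ^ l) n).
    - apply sum_n_le. intros l _. unfold y. rewrite Rpow_mult_distr.
      replace (G k * (q ^ l * H l)) with (q ^ l * (G k * H l)) by ring.
      replace (Z * D ^ k * (q ^ l * D ^ l)) with (q ^ l * (Z * D ^ (k + l)))
        by (rewrite pow_add; ring).
      apply Rmult_le_compat_l; [apply pow_le; lra | apply HGH].
    - rewrite sum_n_Rmult_l. replace (2 * Z * D ^ k) with (Z * D ^ k * 2) by ring.
      apply Rmult_le_compat_l; [|exact Hgeo].
      apply Rmult_le_pos; [exact HZ | apply pow_le, HD]. }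
  rewrite <- sum_n_Rmult_r. apply Rle_trans with (sum_n (fun k => 2 * Z * y ^ k) n).
  - apply sum_n_le. intros k _. unfold y. rewrite Rpow_mult_distr.
    replace (2 * Z * (q ^ k * D ^ k)) with (q ^ k * (2 * Z * D ^ k)) by ring.
    rewrite Rmult_assoc. apply Rmult_le_compat_l; [apply pow_le, Hq | apply Hk].
  - rewrite sum_n_Rmult_l. replace (4 * Z) with (2 * Z * 2) by ring.
    apply Rmult_le_compat_l; [lra | exact Hgeo].
Qed.

Lemma doubling_growth (B : nat -> R) (C : R) (n0 N : nat) :
  (forall m n, (n0 <= m <= n)%nat -> B m <= B n) ->
  (forall n, (n0 <= n)%nat -> B (2 * n)%nat <= C * B n) ->
  0 <= C -> (n0 <= N)%nat ->
  forall k, B ((k + 1) * N)%nat <= C ^ k * B N.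
Proof.
  intros Hmono Hdbl HC HN k.
  assert (Hpow : forall k, (k + 1 <= 2 ^ k)%nat)
    by (intros i; induction i as [|i IHi]; simpl; lia).
  apply Rle_trans with (B (2 ^ k * N)%nat).
  - specialize (Hpow k). apply Hmono; nia.
  - induction k as [|k IH]; [simpl; rewrite Nat.add_0_r; lra|].
    replace (2 ^ S k * N)%nat with (2 * (2 ^ k * N))%nat by (simpl; lia).
    eapply Rle_trans; [apply Hdbl; specialize (Hpow k); nia|].
    simpl pow. rewrite Rmult_assoc. apply Rmult_le_compat_l; assumption.
Qed.

Section Transfer.

Variables (b : nat -> R) (C : R) (n0 : nat).
Hypothesis b_nonneg : forall n, (n0 <= n)%nat -> 0 <= b n.
Hypothesis C_ge_1 : 1 <= C.
Hypothesis b_doubling : forall n, (n0 <= n)%nat -> psum b (2 * n) <= C * psum b n.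
Hypothesis b_radius : Rbar_le 1 (CV_radius b).
Hypothesis b_divergent : is_lim_seq (psum b) p_infty.

Lemma PSeries_at_left_1_infinite :
  filterlim (PSeries b) (at_left 1) (Rbar_locally p_infty).
Proof.
  intros P [X HX]. set (head := psum (fun k => Rabs (b k)) n0).
  assert (Hlarge : eventually (fun n => 2 * (Rmax X 0 + head) < psum b n))
    by (apply b_divergent; exists (2 * (Rmax X 0 + head)); auto).
  destruct Hlarge as [n1 Hn1]. set (n := Nat.max n0 n1). specialize (Hn1 n ltac:(lia)).
  assert (Hhead : 0 <= head) by (apply psum_nonneg; intros; apply Rabs_pos).
  change (at_left 1 (fun x => P (PSeries b x))).
  apply (filter_imp (fun x => 0 < x < 1 /\ / 2 < x ^ n)).
  2:{ apply filter_and; [apply at_left_interval | apply at_left_1_pow_gt]; lra. }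
  intros x [Hx Hxn]. apply HX.
  eapply Rlt_le_trans; [|apply (PSeries_ge_psum b n0 n x)]; try assumption; try lra || lia.
  - fold head. pose proof (Rmax_l X 0). pose proof (Rmax_r X 0). nra.
  - apply (ex_pseries_in_disk 1); [assumption | lra].
Qed.

(* Since the weight [x ^ N] of a block of length [N] beats the cube of the doubling constant,
   the tails of both series are dominated by their first block. *)
Lemma trunc_product_bound (f g : nat -> R) (eta x : R) (N k : nat) :
  (forall n, 0 <= f n) -> (forall n, 0 <= g n) -> (n0 <= N)%nat ->
  (forall n, (N <= n)%nat -> psum f n * psum g n <= eta * psum b n ^ 3) ->
  0 <= eta -> 0 <= psum b N -> 0 <= x <= 1 -> x ^ N * C ^ 3 <= / 2 ->
  trunc f ((k + 1) * N) x * trunc g ((k + 1) * N) x <= 4 * (eta * psum b N ^ 3).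
Proof.
  intros Hf Hg HN Hfg Heta HBN Hx HxN.
  eapply Rle_trans.
  { apply Rmult_le_compat; [apply trunc_nonneg; [assumption | lra] .. | |];
      apply trunc_block_bound; assumption. }
  apply weighted_sums_product_le with (C ^ 3).
  - apply pow_le; lra.
  - apply pow_le; lra.
  - exact HxN.
  - apply Rmult_le_pos; [exact Heta | apply pow_le, HBN].
  - intros i j. set (m := Nat.max i j).
    apply Rle_trans with (psum f ((m + 1) * N) * psum g ((m + 1) * N)).
    { apply Rmult_le_compat; try (apply psum_nonneg; assumption);
        apply psum_monotone with O; auto; nia. }
    eapply Rle_trans; [apply Hfg; nia|].
    rewrite Rmult_assoc. apply Rmult_le_compat_l; [exact Heta|].
    apply Rle_trans with ((C ^ m * psum b N) ^ 3).
    { apply pow_incr. split.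
      - apply Rle_trans with (psum b N); [exact HBN|]. apply psum_monotone with n0; auto; nia.
      - apply doubling_growth with n0; auto; [|lra].
        intros; apply psum_monotone with n0; auto. }
    rewrite Rpow_mult_distr, Rmult_comm. apply Rmult_le_compat_l; [apply pow_le, HBN|].
    rewrite <- !pow_mult. apply Rle_pow; [exact C_ge_1 | lia].
Qed.

Lemma PSeries_product_bound (f g : nat -> R) (eta x : R) (N : nat) :
  (forall n, 0 <= f n) -> (forall n, 0 <= g n) -> (n0 <= N)%nat -> (1 <= N)%nat ->
  (forall n, (N <= n)%nat -> psum f n * psum g n <= eta * psum b n ^ 3) ->
  0 <= eta -> 0 <= psum b N -> 0 <= x <= 1 -> x ^ N * C ^ 3 <= / 2 ->
  ex_pseries f x -> ex_pseries g x ->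
  PSeries f x * PSeries g x <= 4 * (eta * psum b N ^ 3).
Proof.
  intros Hf Hg HN HN1 Hfg Heta HBN Hx HxN Hexf Hexg.
  eapply (is_lim_seq_le (fun k => trunc f k x * trunc g k x) _ (Finite _) (Finite _)).
  - intros k. eapply Rle_trans; [|apply (trunc_product_bound f g eta x N k); assumption].
    apply Rmult_le_compat; try (apply trunc_nonneg; [assumption | lra]);
      (apply sum_n_le_index; [nia|]; intros; apply Rmult_le_pos; [auto | apply pow_le; lra]).
  - apply is_lim_seq_mult'; apply is_lim_seq_trunc; assumption.
  - apply is_lim_seq_const.
Qed.

Lemma PSeries_product_le_of_scale (f g : nat -> R) (eps x : R) (N : nat) :
  let s := / (2 * C ^ 3) in
  (forall n, 0 <= f n) -> (forall n, 0 <= g n) -> ex_pseries f x -> ex_pseries g x ->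
  0 <= eps -> 0 <= x < 1 -> s / 2 <= x ^ N <= s -> (n0 <= N)%nat -> (1 <= N)%nat ->
  4 * psum (fun k => Rabs (b k)) n0 <= s * psum b N ->
  (forall n, (N <= n)%nat -> psum f n * psum g n <= eps * (s / 4) ^ 3 / 4 * psum b n ^ 3) ->
  PSeries f x * PSeries g x <= eps * PSeries b x ^ 3.
Proof.
  intros s Hf Hg Hexf Hexg Heps Hx HxN HN HN1 Hhead Hfg.
  assert (HC3 : 1 <= C ^ 3) by (apply pow_R1_Rle, C_ge_1).
  assert (Hs : 0 < s) by (apply Rinv_0_lt_compat; lra).
  assert (Hhead0 : 0 <= psum (fun k => Rabs (b k)) n0)
    by (apply psum_nonneg; intros; apply Rabs_pos).
  assert (HbN : 0 <= psum b N) by nra.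
  assert (Hbx : s / 4 * psum b N <= PSeries b x).
  { pose proof (PSeries_ge_psum b n0 N x (ex_pseries_in_disk 1 b x b_radius Hx)
      ltac:(lra) b_nonneg HN). nra. }
  apply Rle_trans with (4 * (eps * (s / 4) ^ 3 / 4 * psum b N ^ 3)).
  - apply PSeries_product_bound; try assumption; try lra.
    + pose proof (pow_le (s / 4) 3 ltac:(lra)). nra.
    + replace (/ 2) with (s * C ^ 3) by (unfold s; field; lra). nra.
  - replace (4 * _) with (eps * (s / 4 * psum b N) ^ 3) by field.
    apply Rmult_le_compat_l; [exact Heps|]. apply pow_incr. split; [nra | exact Hbx].
Qed.

Lemma PSeries_product_negligible (f g : nat -> R) (eps : R) :
  (forall n, 0 <= f n) -> (forall n, 0 <= g n) ->
  (forall x, 0 <= x < 1 -> ex_pseries f x) -> (forall x, 0 <= x < 1 -> ex_pseries g x) ->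
  is_lim_seq (fun n => psum f n * psum g n / psum b n ^ 3) 0 -> 0 < eps ->
  at_left 1 (fun x => PSeries f x * PSeries g x <= eps * PSeries b x ^ 3).
Proof.
  intros Hf Hg Hexf Hexg Hlim Heps.
  assert (HC3 : 1 <= C ^ 3) by (apply pow_R1_Rle, C_ge_1).
  set (s := / (2 * C ^ 3)). set (head := psum (fun k => Rabs (b k)) n0).
  assert (Hs : 0 < s < 1).
  { split; [apply Rinv_0_lt_compat; lra|]. rewrite <- Rinv_1. apply Rinv_lt_contravar; lra. }
  assert (Hratio : eventually (fun n => psum f n * psum g n / psum b n ^ 3
                                        < eps * (s / 4) ^ 3 / 4)).
  { apply (Hlim (fun y => y < _)), open_lt. pose proof (pow_lt (s / 4) 3). nra. }
  assert (Hlarge : eventually (fun n => Rmax 0 (4 * head / s) < psum b n))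
    by (apply (b_divergent (fun y => _ < y)); exists (Rmax 0 (4 * head / s)); auto).
  destruct (filter_and _ _ Hratio Hlarge) as [n1 Hn1].
  apply (filter_imp (fun x => 0 < x < 1 /\
    exists N, (n0 + n1 + 1 <= N)%nat /\ s / 2 <= x ^ N <= s)).
  2:{ apply filter_and; [apply at_left_interval; lra | apply at_left_1_exists_pow, Hs]. }
  intros x [Hx [N [HN HxN]]].
  assert (Hpsum : forall n, (N <= n)%nat -> 0 < psum b n /\ 4 * head / s < psum b n)
    by (intros n Hn; apply Rmax_Rlt, Hn1; lia).
  apply PSeries_product_le_of_scale with N; auto; try lra; try lia.
  - apply Hexf; lra.
  - apply Hexg; lra.
  - destruct (Hpsum N (le_n N)) as [_ Hhead]. apply Rlt_div_l in Hhead; [|lra].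
    fold s head. lra.
  - intros n Hn. apply Rlt_le, Rlt_div_l.
    + apply pow_lt, Hpsum, Hn.
    + apply Hn1. lia.
Qed.

End Transfer.

(** * The case of divergent partial sums *)

Lemma trunc_one_ge (x : R) m : 0 <= x <= 1 -> INR (S m) * x ^ m <= trunc (fun _ => 1) m x.
Proof.
  intros Hx. rewrite <- sum_n_const. apply sum_n_le.
  intros k Hk. rewrite Rmult_1_l. apply pow_antitone; assumption.
Qed.

Lemma perturbed_square_root_lower_bound (A B Sb Se E x kappa : R) :
  0 < x < 1 -> 0 < kappa <= 1 -> 0 <= A -> 1 <= kappa * B -> 0 <= Se ->
  A ^ 2 = B ^ 2 + (1 - x) * E -> (1 - x) * B ^ 2 <= Sb -> (1 - x) * E ^ 2 <= Se ->
  Sb * Se <= B ^ 3 ->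
  (1 - kappa) * B <= A.
Proof.
  intros Hx Hk HA HB HSe Hid HSb HE Hprod.
  assert (HB1 : 1 <= B) by nra.
  assert (HSeB : (1 - x) * Se <= B).
  { apply Rmult_le_reg_r with (B ^ 2); [nra|]. apply Rle_trans with (Sb * Se); [|lra].
    replace ((1 - x) * Se * B ^ 2) with ((1 - x) * B ^ 2 * Se) by ring.
    apply Rmult_le_compat_r; assumption. }
  assert (Hsqr : ((1 - x) * E) ^ 2 <= B ^ 2).
  { apply Rle_trans with ((1 - x) * Se); [|nra].
    replace (((1 - x) * E) ^ 2) with ((1 - x) * ((1 - x) * E ^ 2)) by ring.
    apply Rmult_le_compat_l; lra. }
  assert (Herror : - B <= (1 - x) * E) by nra.
  assert (HBk : B <= kappa * B ^ 2) by nra.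
  assert (Hcmp : ((1 - kappa) * B) ^ 2 <= A ^ 2).
  { assert (0 <= kappa * (1 - kappa) * B ^ 2)
      by (apply Rmult_le_pos; [nra | apply pow2_ge_0]).
    nra. }
  rewrite <- !Rsqr_pow2 in Hcmp. apply Rsqr_incr_0_var; assumption.
Qed.

Lemma averaged_upper_bound (A B Sb Se x kappa : R) :
  0 < x < 1 -> 0 < kappa <= / 2 -> 1 <= B -> 0 < Sb ->
  (1 - x) * B ^ 2 <= Sb -> Sb * Se <= kappa ^ 3 / 2 * B ^ 3 ->
  (forall m tau, 0 < tau ->
     trunc (fun _ => 1) m x * A
     <= INR (S m) * trunc (fun _ => 1) m x * Sb + (tau * trunc (fun _ => 1) m x + / tau * Se)) ->
  A <= 3 * kappa * B + Sb.
Proof.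
  intros Hx Hk HB HSb HCS Hprod Havg.
  assert (HkB : 0 < kappa * B) by nra.
  destruct (nfloor1_ex (kappa * B / Sb)) as [m [Hm HSm]]; [apply Rdiv_lt_0_compat; assumption|].
  apply Rlt_div_r in Hm; [|exact HSb]. rewrite <- S_INR in HSm.
  apply Rle_div_l in HSm; [|exact HSb].
  assert (HSm' : INR (S m) * Sb <= kappa * B + Sb) by (rewrite S_INR; lra).
  assert (Hshort : INR m * (1 - x) <= / 2).
  { assert (INR m * ((1 - x) * B ^ 2) <= INR m * Sb)
      by (apply Rmult_le_compat_l; [apply pos_INR | exact HCS]).
    apply Rmult_le_reg_r with (B ^ 2); [nra|]. nra. }
  assert (HP : INR (S m) / 2 <= trunc (fun _ => 1) m x).
  { eapply Rle_trans; [|apply trunc_one_ge; lra].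
    apply Rmult_le_compat_l; [apply pos_INR|].
    pose proof (bernoulli_pow x m ltac:(lra)). lra. }
  assert (HM : 1 <= INR (S m)) by (rewrite S_INR; pose proof (pos_INR m); lra).
  specialize (Havg m (kappa * B) HkB).
  revert Havg HP. generalize (trunc (fun _ => 1) m x) as P. intros P Havg HP.
  assert (HSe : / (kappa * B) * Se <= kappa * B * P).
  { apply Rmult_le_reg_l with (kappa * B * Sb); [apply Rmult_lt_0_compat; assumption|].
    replace (kappa * B * Sb * (/ (kappa * B) * Se)) with (Sb * Se) by (field; lra).
    apply Rle_trans with ((kappa * B) ^ 2 * (kappa * B / 2)); [lra|].
    replace (kappa * B * Sb * (kappa * B * P)) with ((kappa * B) ^ 2 * (P * Sb)) by ring.
    apply Rmult_le_compat_l; [apply pow2_ge_0|]. nra. }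
  apply Rmult_le_reg_l with P; [lra|]. nra.
Qed.

Section Divergent.

Variables (a b e : nat -> R) (rho : R) (n0 : nat).
Hypothesis a_natural : forall n, natural (a n).
Hypothesis a_radius : Rbar_le 1 (CV_radius a).
Hypothesis b_bounds : forall n, (n0 <= n)%nat -> 0 <= b n <= rho.
Hypothesis identity : psum_square_identity a b e.

Let Sb (x : R) : R := PSeries (fun k => b k ^ 2) x.
Let Se (x : R) : R := PSeries (fun k => e k ^ 2) x.

Lemma b_radius_ge_1 : Rbar_le 1 (CV_radius b).
Proof.
  apply CV_radius_ge_1_of_eventually_bounded with rho n0. intros n Hn. specialize (b_bounds n Hn).
  rewrite Rabs_pos_eq; lra.
Qed.

Let e_radius : Rbar_le 1 (CV_radius e) :=
  CV_radius_error a b e a_radius b_radius_ge_1 identity.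

Lemma PSeries_lower_bound (x kappa : R) :
  0 < x < 1 -> 0 < kappa <= 1 -> 1 <= kappa * PSeries b x ->
  Sb x * Se x <= PSeries b x ^ 3 ->
  (1 - kappa) * PSeries b x <= PSeries a x.
Proof.
  intros Hx Hkappa HB Hprod.
  apply (perturbed_square_root_lower_bound _ _ (Sb x) (Se x) (PSeries e x) x);
    try assumption.
  - apply PSeries_nonneg; [apply (ex_pseries_in_disk 1); [exact a_radius | lra] | lra|].
    intros k. destruct (a_natural k) as [i ->]. apply pos_INR.
  - apply PSeries_nonneg; [apply ex_pseries_sqr_unit_disk; [exact e_radius | lra] | lra|].
    intros k. apply pow2_ge_0.
  - apply PSeries_sqr_identity; auto using b_radius_ge_1; lra.
  - apply PSeries_cauchy_schwarz_unit_disk; [apply b_radius_ge_1 | lra].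
  - apply PSeries_cauchy_schwarz_unit_disk; [exact e_radius | lra].
Qed.

Lemma PSeries_upper_bound (x kappa : R) :
  0 < x < 1 -> 0 < kappa <= / 2 -> 1 <= PSeries b x ->
  Sb x * Se x <= kappa ^ 3 / 2 * PSeries b x ^ 3 ->
  PSeries a x <= 3 * kappa * PSeries b x + Sb x.
Proof.
  intros Hx Hkappa HB Hprod.
  assert (HCS : (1 - x) * PSeries b x ^ 2 <= Sb x)
    by (apply PSeries_cauchy_schwarz_unit_disk; [apply b_radius_ge_1 | lra]).
  apply averaged_upper_bound with (Se x) x; try assumption.
  - apply Rlt_le_trans with ((1 - x) * PSeries b x ^ 2); [|exact HCS].
    apply Rmult_lt_0_compat; [lra | apply pow_lt; lra].
  - intros m tau Htau. unfold Sb, Se. rewrite <- (pow2_sqrt x) by lra.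
    apply (PSeries_averaged_inequality a b e); auto using b_radius_ge_1.
    apply sqrt_lt_1_of_lt_1. lra.
Qed.

(* From [(1 - kappa) B <= A <= 3 kappa B + Sb] and [Sb <= rho B + O(1)] one gets
   [(1 - rho - 4 kappa) B = O(1)]; the choice [8 kappa = 1 - rho] leaves [4 kappa B]. *)
Lemma PSeries_bound_of_small_product (x : R) :
  let kappa := (1 - rho) / 8 in
  rho < 1 -> 0 < x < 1 -> / kappa <= PSeries b x ->
  Sb x * Se x <= kappa ^ 3 / 2 * PSeries b x ^ 3 ->
  4 * kappa * PSeries b x <= psum (fun k => Rabs (rho * b k - b k ^ 2)) n0.
Proof.
  intros kappa Hrho1 Hx HB Hprod.
  assert (Hrho0 : 0 <= rho) by (pose proof (b_bounds n0 (le_n _)); lra).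
  assert (Hkappa : 0 < kappa <= / 8) by (unfold kappa; lra).
  assert (HkB : 1 <= kappa * PSeries b x).
  { rewrite <- (Rinv_r kappa) by lra. apply Rmult_le_compat_l; lra. }
  assert (HB1 : 1 <= PSeries b x) by nra.
  assert (Hcube : kappa ^ 3 / 2 * PSeries b x ^ 3 <= PSeries b x ^ 3).
  { pose proof (pow_le_1 kappa 3 ltac:(lra)). pose proof (pow_le (PSeries b x) 3 ltac:(lra)). nra. }
  assert (Hlower : (1 - kappa) * PSeries b x <= PSeries a x)
    by (apply PSeries_lower_bound; lra).
  assert (Hupper : PSeries a x <= 3 * kappa * PSeries b x + Sb x)
    by (apply PSeries_upper_bound; lra).
  assert (Hsqr : Sb x <= rho * PSeries b x + psum (fun k => Rabs (rho * b k - b k ^ 2)) n0).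
  { apply PSeries_sqr_le; [exact b_bounds | lra | |].
    - apply (ex_pseries_in_disk 1); [apply b_radius_ge_1 | lra].
    - apply ex_pseries_sqr_unit_disk; [apply b_radius_ge_1 | lra]. }
  assert (8 * kappa = 1 - rho) by (unfold kappa; field). nra.
Qed.

End Divergent.

Lemma no_psum_square_identity_of_divergent (a b e : nat -> R) (C rho : R) n0 :
  (forall n, natural (a n)) -> Rbar_le 1 (CV_radius a) ->
  (forall n, (n0 <= n)%nat -> 0 <= b n <= rho) -> rho < 1 ->
  1 <= C -> (forall n, (n0 <= n)%nat -> psum b (2 * n) <= C * psum b n) ->
  is_lim_seq (psum b) p_infty ->
  is_lim_seq (fun n => psum (fun k => b k ^ 2) n * psum (fun k => e k ^ 2) n / psum b n ^ 3) 0 ->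
  ~ psum_square_identity a b e.
Proof.
  intros Ha a_radius Hb Hrho HC Hdoubling Hinf Hlim Hid.
  set (kappa := (1 - rho) / 8).
  set (head := psum (fun k => Rabs (rho * b k - b k ^ 2)) n0).
  pose proof (b_radius_ge_1 b rho n0 Hb) as b_radius.
  pose proof (CV_radius_error a b e a_radius b_radius Hid) as e_radius.
  assert (b_nonneg : forall n, (n0 <= n)%nat -> 0 <= b n) by (intros n Hn; apply Hb, Hn).
  assert (Hkappa : 0 < kappa) by (unfold kappa; lra).
  assert (Hlarge : at_left 1 (fun x => Rmax (/ kappa) (head / (4 * kappa)) < PSeries b x)).
  { apply (PSeries_at_left_1_infinite b n0 b_nonneg b_radius Hinf (fun y => _ < y)).
    exists (Rmax (/ kappa) (head / (4 * kappa))). auto. }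
  assert (Hsmall : at_left 1 (fun x =>
    PSeries (fun k => b k ^ 2) x * PSeries (fun k => e k ^ 2) x
    <= kappa ^ 3 / 2 * PSeries b x ^ 3)).
  { apply PSeries_product_negligible with C n0; auto using pow2_ge_0, ex_pseries_sqr_unit_disk.
    pose proof (pow_lt kappa 3 Hkappa). lra. }
  destruct (filter_ex _ (filter_and _ _ (at_left_interval 0 1 Rlt_0_1)
    (filter_and _ _ Hlarge Hsmall))) as [x [Hx [HB Hprod]]].
  apply Rmax_Rlt in HB. destruct HB as [HBkappa HBhead].
  pose proof (PSeries_bound_of_small_product a b e rho n0 Ha a_radius Hb Hid x Hrho Hx
    (Rlt_le _ _ HBkappa) Hprod) as Hbound.
  apply Rlt_div_l in HBhead; [|lra]. fold kappa head in Hbound. lra.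
Qed.

(** * The case of convergent partial sums *)

Lemma psum_limit_dichotomy (f : nat -> R) n0 :
  (forall n, (n0 <= n)%nat -> 0 <= f n) ->
  is_lim_seq (psum f) p_infty \/ exists l : R, is_lim_seq (psum f) l.
Proof.
  intros Hf. set (u := fun n => psum f (n + n0)).
  assert (Hincr : forall m n, (m <= n)%nat -> u m <= u n)
    by (intros m n Hmn; apply psum_monotone with n0; [exact Hf | lia]).
  destruct (ex_lim_seq_incr u) as [l Hl]; [intros; apply Hincr; lia|].
  pose proof (is_lim_seq_le _ _ _ _ (fun n => Hincr O n (Nat.le_0_l n))
    (is_lim_seq_const (u O)) Hl) as Hbelow.
  apply is_lim_seq_incr_n in Hl.
  destruct l as [l| |]; [right; exists l | left | contradiction]; exact Hl.
Qed.

Lemma psum_eventually_nonzero (f : nat -> R) n0 :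
  (forall n, (n0 <= n)%nat -> 0 < f n) -> eventually (fun n => psum f n <> 0).
Proof.
  intros Hf.
  destruct (classic (exists n, (n0 <= n)%nat /\ psum f n = 0)) as [[n [Hn H0]]|Hno].
  - exists (S n). intros k Hk.
    assert (Hle : psum f (S n) <= psum f k)
      by (apply psum_monotone with n0; [intros; apply Rlt_le, Hf; assumption | lia]).
    specialize (Hf (S n) ltac:(lia)). unfold psum in *. simpl in Hle. lra.
  - exists n0. intros k Hk H0. apply Hno. exists k. split; assumption.
Qed.

Lemma error_zero_of_convergent_psum (b e : nat -> R) (l : R) n0 :
  (forall n, (n0 <= n)%nat -> 0 < b n) -> is_lim_seq (psum b) l ->
  is_lim_seq (fun n => psum (fun k => b k ^ 2) n * psum (fun k => e k ^ 2) n / psum b n ^ 3) 0 ->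
  forall m, e m = 0.
Proof.
  intros Hb Hl Hlim m. apply NNPP. intros Hm.
  set (num := fun n => psum (fun k => b k ^ 2) n * psum (fun k => e k ^ 2) n) in *.
  assert (Hnum : is_lim_seq num 0).
  { replace 0 with (0 * (l * l * l)) by ring.
    apply is_lim_seq_ext_loc
      with (fun n => num n / psum b n ^ 3 * (psum b n * psum b n * psum b n)).
    - apply (filter_imp (fun n => psum b n <> 0)); [intros n Hn; field; exact Hn|].
      apply psum_eventually_nonzero with n0, Hb.
    - repeat apply is_lim_seq_mult'; assumption. }
  assert (Hpos : 0 < b n0 ^ 2 * e m ^ 2).
  { apply Rmult_lt_0_compat; [apply pow_lt, Hb; lia|].
    rewrite <- Rsqr_pow2. apply Rsqr_pos_lt, Hm. }
  assert (Hle : Rbar_le (b n0 ^ 2 * e m ^ 2) 0).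
  { apply (is_lim_seq_le_loc (fun _ => b n0 ^ 2 * e m ^ 2) num);
      [| apply is_lim_seq_const | exact Hnum].
    exists (Nat.max n0 m). intros n Hn. apply Rmult_le_compat; try apply pow2_ge_0.
    - apply (psum_ge_term (fun k => b k ^ 2)); [intros; apply pow2_ge_0 | lia].
    - apply (psum_ge_term (fun k => e k ^ 2)); [intros; apply pow2_ge_0 | lia]. }
  simpl in Hle. lra.
Qed.

Lemma psum_inj (f g : nat -> R) : (forall n, psum f n = psum g n) -> forall n, f n = g n.
Proof.
  intros H [|n]; [exact (H O)|].
  pose proof (H n) as Hn. pose proof (H (S n)) as HSn. unfold psum in *. simpl in HSn. lra.
Qed.

Lemma psum_single (f : nat -> R) i n :
  (i <= n)%nat -> (forall k, (k <= n)%nat -> k <> i -> f k = 0) -> psum f n = f i.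
Proof.
  intros Hi Hf. unfold psum. induction n as [|n IH].
  - replace i with O by lia. reflexivity.
  - simpl. destruct (Nat.eq_dec i (S n)) as [->|Hne].
    + rewrite (sum_eq _ (fun _ => 0)) by (intros; apply Hf; lia). rewrite sum_cte. ring.
    + rewrite IH, (Hf (S n)) by (lia || (intros; apply Hf; lia)). ring.
Qed.

Lemma PS_mult_integral (f g : nat -> R) :
  (forall n, PS_mult f g n = 0) -> (forall n, f n = 0) \/ (forall n, g n = 0).
Proof.
  intros Hfg. apply NNPP. intros Hno. apply not_or_and in Hno. destruct Hno as [Hf Hg].
  apply not_all_ex_not, least_index in Hf. apply not_all_ex_not, least_index in Hg.
  destruct Hf as [i [Hi Hf]], Hg as [j [Hj Hg]].
  assert (Hlowest : f i * g j = 0).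
  { rewrite <- (Hfg (i + j)%nat). unfold PS_mult. symmetry.
    replace (g j) with (g (i + j - i)%nat) by (f_equal; lia).
    apply (psum_single (fun k => f k * g (i + j - k)%nat)); [lia|].
    intros k Hk Hki. destruct (Nat.lt_ge_cases k i) as [Hlt|Hge].
    - rewrite (NNPP _ (Hf k Hlt)). ring.
    - rewrite (NNPP _ (Hg (i + j - k)%nat ltac:(lia))). ring. }
  apply Rmult_integral in Hlowest. tauto.
Qed.

Lemma PS_mult_comm (f g : nat -> R) n : PS_mult f g n = PS_mult g f n.
Proof.
  unfold PS_mult. rewrite <- sum_f_R0_skip. apply sum_eq. intros k Hk.
  replace (n - (n - k))%nat with k by lia. apply Rmult_comm.
Qed.

Lemma PS_mult_self_inj (f g : nat -> R) :
  (forall n, PS_mult f f n = PS_mult g g n) ->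
  (forall n, f n = g n) \/ (forall n, f n = - g n).
Proof.
  intros Hfg.
  destruct (PS_mult_integral (fun k => f k - g k) (fun k => f k + g k)) as [Hsub|Hadd].
  - intros n. transitivity (PS_mult f f n - PS_mult g g n + (PS_mult f g n - PS_mult g f n)).
    + unfold PS_mult. rewrite <- !minus_sum, <- plus_sum. apply sum_eq. intros. ring.
    + rewrite Hfg, (PS_mult_comm f g). ring.
  - left. intros n. specialize (Hsub n). lra.
  - right. intros n. specialize (Hadd n). lra.
Qed.

Lemma LimSup_seq_lt_eventually (u : nat -> R) (l : R) :
  Rbar_lt (LimSup_seq u) l -> exists rho, rho < l /\ eventually (fun n => u n <= rho).
Proof.
  unfold LimSup_seq. destruct (ex_LimSup_seq u) as [[s| |] Hs]; simpl; intros Hl; [| easy |].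
  - assert (Heps : 0 < (l - s) / 2) by lra.
    destruct (Hs (mkposreal _ Heps)) as [_ [n0 Hn0]]. simpl in Hn0.
    exists (s + (l - s) / 2). split; [lra|]. exists n0. intros n Hn. apply Rlt_le, Hn0, Hn.
  - destruct (Hs (l - 1)) as [n0 Hn0]. exists (l - 1). split; [lra|].
    exists n0. intros n Hn. apply Rlt_le, Hn0, Hn.
Qed.

Lemma natural_chi (A : nat -> bool) n : natural (chi A n).
Proof. unfold chi. destruct (A n); [exists 1%nat | exists O]; reflexivity. Qed.

Lemma CV_radius_chi_ge_1 (A : nat -> bool) : Rbar_le 1 (CV_radius (chi A)).
Proof.
  apply CV_radius_ge_1_of_eventually_bounded with 1 O. intros n _.
  unfold chi. destruct (A n); rewrite ?Rabs_R1, ?Rabs_R0; lra.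
Qed.

Lemma doubling_of_ratio_bound (u : nat -> R) (C : R) :
  is_lim_seq u p_infty -> eventually (fun n => u (2 * n)%nat / u n < C) ->
  eventually (fun n => u (2 * n)%nat <= Rmax 1 C * u n).
Proof.
  intros Hu HC.
  assert (Hpos : eventually (fun n => 0 < u n)) by (apply (Hu (Rlt 0)); exists 0; auto).
  destruct (filter_and _ _ Hpos HC) as [n0 Hn0]. exists n0. intros n Hle.
  destruct (Hn0 n Hle) as [Hn Hratio]. apply Rlt_div_l in Hratio; [|exact Hn].
  pose proof (Rmax_r 1 C). nra.
Qed.

Lemma no_psum_square_identity_of_convergent (A : nat -> bool) (b e : nat -> R) (l : R) n0 :
  (forall n, (n0 <= n)%nat -> 0 < b n < 1) -> is_lim_seq (psum b) l ->
  is_lim_seq (fun n => psum (fun k => b k ^ 2) n * psum (fun k => e k ^ 2) n / psum b n ^ 3) 0 ->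
  ~ psum_square_identity (chi A) b e.
Proof.
  intros Hb Hl Hlim Hid.
  assert (He : forall n, e n = 0).
  { apply (error_zero_of_convergent_psum b e l n0); [|assumption|assumption].
    intros n Hn. apply Hb, Hn. }
  assert (Hsquare : forall n, PS_mult (chi A) (chi A) n = PS_mult b b n)
    by (apply psum_inj; intros n; rewrite Hid, He; ring).
  specialize (Hb n0 (le_n n0)).
  destruct (PS_mult_self_inj _ _ Hsquare) as [Heq|Heq]; specialize (Heq n0); unfold chi in Heq;
    destruct (A n0); lra.
Qed.

Theorem theorem3 (b e : nat -> R) :
  (exists n0 : nat, forall n, (n0 <= n)%nat -> 0 < b n) ->
  (exists C : R, exists n0 : nat, forall n, (n0 <= n)%nat ->
       psum b (2 * n) / psum b n < C) ->
  Rbar_lt (LimSup_seq b) (Finite 1) ->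
  is_lim_seq (fun n => psum (fun k => b k ^ 2) n * psum (fun k => e k ^ 2) n
                       / (psum b n) ^ 3) 0 ->
  ~ (exists A : nat -> bool, forall N : nat,
        psum (RA A) N = psum (conv b) N + e N).
Proof.
  intros Hpos [C Hratio] Hsup Hlim [A HA].
  destruct (LimSup_seq_lt_eventually b 1 Hsup) as [rho [Hrho Hle]].
  destruct (filter_and _ _ Hpos Hle) as [n0 Hb].
  destruct (psum_limit_dichotomy b n0) as [Hinf|[l Hl]].
  - intros n Hn. apply Rlt_le, Hb, Hn.
  - destruct (doubling_of_ratio_bound (psum b) C Hinf Hratio) as [n1 Hdbl].
    apply (no_psum_square_identity_of_divergent (chi A) b e (Rmax 1 C) rho (n0 + n1));
      try assumption.
    + apply natural_chi.
    + apply CV_radius_chi_ge_1.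
    + intros n Hn. specialize (Hb n ltac:(lia)). lra.
    + apply Rmax_l.
    + intros n Hn. apply Hdbl. lia.
  - apply (no_psum_square_identity_of_convergent A b e l n0); try assumption.
    intros n Hn. specialize (Hb n Hn). lra.
Qed.
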